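(* Suppose $F\in\mathbb{P}(\mathbb{Z}^+)$ satisfies $F(k)=\sum_{j=1}^Nc_jk^{-1-\alpha_j}+P(k)$ for all $k\in\mathbb{N}$, where $N\in\mathbb{N}$, $0<\alpha_1<\cdots<\alpha_N<1$, $c_1,\dots,c_N>0$, and $P\in L^1(\mathbb{Z}^+)$ with $\sum_{k\ge1}k|P(k)|<\infty$. Then $F$ is aperiodic and there exist $\varepsilon\in(0,1)$, $c>0$ with $1-\mathrm{Re}\,\widehat{F}(\xi)\ge\varepsilon|\xi|^{\alpha_1}$ for all $\xi\in[-\varepsilon,\varepsilon]$ and $|\partial_\xi\widehat{F}(\xi)|\le c|\xi|^{\alpha_1-1}$ for all $\xi\in[-\pi,\pi]\setminus\{0\}$. Consequently $F\in\mathcal{A}$.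
   Context: $L^1(\mathbb{Z}^+)$ is the set of summable $F:\mathbb{Z}\to\mathbb{C}$ vanishing on negative integers; $\mathbb{P}(\mathbb{Z}^+)$ those with $F\ge0$, $\sum F=1$. $\widehat{F}(\xi)=\sum_kF(k)e^{-ik\xi}$. $F$ is adapted if $\mathrm{supp}(F)$ generates the group $\mathbb{Z}$, aperiodic if every translate $\delta_m*F$ ($m\in\mathbb{Z}$) is adapted. $F^{(n)}$ is the $n$-th convolution power and $\mathcal{A}=\{F\in\mathbb{P}(\mathbb{Z}^+):\sup_{n\in\mathbb{N}}n\sum_k|F^{(n)}(k)-F^{(n+1)}(k)|<\infty\}$. *)

(* Defs.v *)
From Stdlib Require Import Reals ZArith List.
From Coquelicot Require Import Coquelicot.
Open Scope R_scope.

(* Functions Z -> R; the paper's F : Z -> C vanishing on negative integers.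
   A probability F is real, so we take real-valued F. *)

Definition vanishes_neg (F : Z -> R) : Prop := forall k : Z, (k < 0)%Z -> F k = 0.

Definition prob_Zplus (F : Z -> R) : Prop :=
  vanishes_neg F /\ (forall k, 0 <= F k) /\
  is_series (fun n : nat => F (Z.of_nat n)) 1.

Definition supp (F : Z -> R) : Z -> Prop := fun k => F k <> 0.

Definition generates_Z (S : Z -> Prop) : Prop :=
  forall z : Z, exists l : list (Z * Z)%type,
    List.Forall (fun p => S (snd p)) l /\
    z = List.fold_right (fun p acc => Z.add (Z.mul (fst p) (snd p)) acc) 0%Z l.

Definition adapted (F : Z -> R) : Prop := generates_Z (supp F).

Definition translate (m : Z) (F : Z -> R) : Z -> R := fun k => F (k - m)%Z.

Definition aperiodic (F : Z -> R) : Prop := forall m : Z, adapted (translate m F).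

(* convolution of two functions vanishing on negative integers:
   (F*G)(k) = sum_{j=0}^{k} F(j) G(k-j) for k >= 0, and 0 for k < 0 *)
Definition conv (F G : Z -> R) : Z -> R := fun k =>
  if (k <? 0)%Z then 0
  else sum_f_R0 (fun j => F (Z.of_nat j) * G (k - Z.of_nat j)%Z) (Z.to_nat k).

Definition delta0 : Z -> R := fun k => if (k =? 0)%Z then 1 else 0.

Fixpoint convpow (F : Z -> R) (n : nat) : Z -> R :=
  match n with
  | O => delta0
  | S m => conv F (convpow F m)
  end.

(* the class A: sup_n n * sum_k |F^(n)(k) - F^(n+1)(k)| < oo
   (the sums are over k >= 0, all functions vanish on negatives) *)
Definition classA (F : Z -> R) : Prop :=
  prob_Zplus F /\
  exists M : R, forall n : nat, (1 <= n)%nat ->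
    ex_series (fun k : nat => Rabs (convpow F n (Z.of_nat k) - convpow F (S n) (Z.of_nat k))) /\
    INR n * Series (fun k : nat => Rabs (convpow F n (Z.of_nat k) - convpow F (S n) (Z.of_nat k))) <= M.

(* Fourier transform  F^(xi) = sum_k F(k) e^{-i k xi}  for real F vanishing on negatives *)
Definition Fhat (F : Z -> R) (xi : R) : C :=
  (Series (fun k : nat => F (Z.of_nat k) * cos (INR k * xi)),
   - Series (fun k : nat => F (Z.of_nat k) * sin (INR k * xi))).

(* Main.v *)
(* Write F = G + P with G the sum of the power terms and a = alpha_1.

   Membership in A needs no Fourier analysis. Let D be the difference operator,
   D h (k) = h k - h (k-1), and u_n the l^1 norm of D F^(n). For each large K split
   F = A + B with B = G on (K, oo): then |A|_1 <= 1 - c K^(-a), because the first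
   moment of P makes it negligible beyond K, and |D B|_1 <= 2 G(K+1) <= C K^(-1-a),
   because G decreases. As D commutes with convolution by either factor,
   u_(n+1) <= (1 - c K^(-a)) u_n + C K^(-1-a), and K ~ n^(1/a) yields u_n = O(n^(-1/a)).
   Finally delta_0 - F = D T for the tail T(k) = sum_(j > k) F(j) = O(k^(-a)), so
   F^(n) - F^(n+1) = D (T * F^(n)) has norm at most
   |T 1_[0,K]|_1 u_n + |D (T 1_(K,oo))|_1 = O(K^(1-a) n^(-1/a) + K^(-a)) = O(1/n).

   The lower bound on 1 - Re F^ keeps only the terms K < k <= 2K with K ~ 1/|xi|.
   Termwise differentiation away from 0 and the bound on the derivative follow from
   Abel summation, as k G(k) decreases to 0. Two consecutive points lie in the support,
   since otherwise |P(k-1)| + |P(k)| >= G(k) for all k, against the first moment of P. *)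

Require Import Defs.
From Stdlib Require Import Reals ZArith List Lia Lra Classical.
From Coquelicot Require Import Coquelicot.
Open Scope R_scope.

(** * Partial sums compared with real powers *)

Lemma sum_increment_le (u v : nat -> R) (m n : nat) :
  (m <= n)%nat -> (forall k, (m < k <= n)%nat -> u k <= v k) ->
  sum_f_R0 u n - sum_f_R0 u m <= sum_f_R0 v n - sum_f_R0 v m.
Proof.
  intros Hmn; induction Hmn as [|n Hmn IH]; intros Huv; [lra|].
  rewrite !tech5.
  assert (H := Huv (S n) ltac:(lia)).
  assert (H' := IH (fun k Hk => Huv k ltac:(lia))). lra.
Qed.

Lemma sum_increment_ge0 (u : nat -> R) (m n : nat) :
  (m <= n)%nat -> (forall k, (m < k <= n)%nat -> 0 <= u k) ->
  0 <= sum_f_R0 u n - sum_f_R0 u m.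
Proof.
  intros Hmn Hu.
  assert (H := sum_increment_le (fun _ => 0) u m n Hmn Hu).
  rewrite !sum_cte in H; lra.
Qed.

Lemma Rpower_exp_ineq (t s : R) : 1 + s * ln t <= Rpower t s.
Proof. unfold Rpower. apply exp_ineq1_le. Qed.

Lemma ln_le_minus_1 (t : R) : 0 < t -> ln t <= t - 1.
Proof.
  intros Ht. assert (H := exp_ineq1_le (ln t)). rewrite exp_ln in H; lra.
Qed.

Lemma Rpower_bernoulli (t s : R) :
  0 < t -> 0 <= s <= 1 -> Rpower t s <= 1 - s + s * t.
Proof.
  intros Ht Hs. unfold Rpower.
  set (m := s * ln t).
  (* the tangent line of [exp] at [m] lies below [exp] at [ln t] and at [0] *)
  assert (H1 := exp_ineq1_le (ln t - m)).
  assert (H2 := exp_ineq1_le (- m)).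
  assert (E1 : t = exp m * exp (ln t - m))
    by (rewrite <- exp_plus, <- (exp_ln t) at 1 by lra; f_equal; ring).
  assert (E2 : 1 = exp m * exp (- m))
    by (rewrite <- exp_plus, <- exp_0; f_equal; ring).
  assert (Hm := exp_pos m).
  assert (H3 : exp m * (1 + (ln t - m)) <= t) by (rewrite E1 at 2; nra).
  assert (H4 : exp m * (1 - m) <= 1) by (rewrite E2 at 2; nra).
  assert (s * (exp m * (1 + (ln t - m))) <= s * t) by nra.
  assert ((1 - s) * (exp m * (1 - m)) <= (1 - s) * 1) by nra.
  assert (exp m * (s * ln t - m) = 0) by (unfold m; ring).
  nra.
Qed.

Lemma Rpower_pos (x y : R) : 0 < Rpower x y.
Proof. apply exp_pos. Qed.

Lemma Rpower_le_anti (x y s : R) :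
  0 < x <= y -> s <= 0 -> Rpower y s <= Rpower x s.
Proof.
  intros Hxy Hs. replace s with (- - s) by ring.
  rewrite !(Rpower_Ropp _ (- s)).
  apply Rinv_le_contravar; [apply Rpower_pos|].
  apply Rle_Rpower_l; lra.
Qed.

Lemma mul_Rpower (x s : R) : 0 < x -> x * Rpower x s = Rpower x (1 + s).
Proof. intros Hx. rewrite Rpower_plus, Rpower_1; [reflexivity|lra]. Qed.

(** Integral comparison by telescoping: with [x = K + 1], Bernoulli's inequality at [t = K / x]
    gives (1-a) x^(-a) <= x^(1-a) - (x-1)^(1-a). *)
Lemma sum_Rpower_upper (b : nat -> R) (a C : R) (K : nat) :
  0 < a < 1 -> 0 <= C -> (1 <= K)%nat ->
  (forall k, (1 <= k)%nat -> b k <= C * Rpower (INR k) (- a)) ->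
  sum_f_R0 b K <= b O + C / (1 - a) * Rpower (INR K) (1 - a).
Proof.
  intros Ha HC HK Hb.
  induction HK as [|K HK IH].
  - simpl.
    assert (H := Hb 1%nat (le_n _)). simpl in H.
    unfold Rpower in *. rewrite ln_1, Rmult_0_r, exp_0 in *.
    assert (1 <= / (1 - a)) by (rewrite <- Rinv_1 at 1; apply Rinv_le_contravar; lra).
    unfold Rdiv. nra.
  - rewrite tech5. assert (H := Hb (S K) ltac:(lia)).
    assert (HK0 : 0 < INR K) by (apply lt_0_INR; lia).
    rewrite S_INR in *. set (x := INR K + 1) in *.
    assert (Hx : 0 < x) by (unfold x; lra).
    assert (HB := Rpower_bernoulli (INR K / x) (1 - a)
      ltac:(apply Rdiv_lt_0_compat; lra) ltac:(lra)).
    assert (E : Rpower (INR K) (1 - a) = Rpower (INR K / x) (1 - a) * Rpower x (1 - a)).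
    { rewrite Rpower_mult_distr by (try apply Rdiv_lt_0_compat; lra).
      f_equal. field. lra. }
    assert (E2 : Rpower x (1 - a) = x * Rpower x (- a))
      by (rewrite mul_Rpower by lra; f_equal; ring).
    assert (Hp := Rpower_pos x (- a)).
    assert (Hstep : (1 - a) * Rpower x (- a) <= Rpower x (1 - a) - Rpower (INR K) (1 - a)).
    { rewrite E, E2.
      assert (E3 : INR K / x * x = x - 1) by (unfold x in *; field; lra).
      assert (Rpower (INR K / x) (1 - a) * (x * Rpower x (- a))
        <= (1 - (1 - a) + (1 - a) * (INR K / x)) * (x * Rpower x (- a)))
        by (apply Rmult_le_compat_r; [apply Rmult_le_pos; lra | exact HB]).
      replace ((1 - (1 - a) + (1 - a) * (INR K / x)) * (x * Rpower x (- a)))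
        with ((a * x + (1 - a) * (INR K / x * x)) * Rpower x (- a)) in H0 by ring.
      rewrite E3 in H0. lra. }
    assert (0 <= C / (1 - a)) by (apply Rdiv_le_0_compat; lra).
    assert (C * Rpower x (- a) = C / (1 - a) * ((1 - a) * Rpower x (- a))) by (field; lra).
    nra.
Qed.

(** Telescoping again: (n/x)^(-a) >= 1 - a ln(n/x) >= 1 + a/x with [x = n + 1], hence a x^(-1-a) <=
    n^(-a) - x^(-a). *)
Lemma sum_Rpower_tail (b : nat -> R) (a C : R) (K n : nat) :
  0 < a -> 0 <= C -> (1 <= K <= n)%nat ->
  (forall k, (1 <= k)%nat -> b k <= C * Rpower (INR k) (- 1 - a)) ->
  sum_f_R0 b n - sum_f_R0 b K <= C / a * Rpower (INR K) (- a).
Proof.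
  intros Ha HC [HK HKn] Hb.
  assert (Hca : 0 <= C / a) by (apply Rdiv_le_0_compat; lra).
  (* The induction runs on the telescoped bound, so the endpoint term n^(-a) is kept until the
     end. *)
  apply Rle_trans with (C / a * (Rpower (INR K) (- a) - Rpower (INR n) (- a))).
  2: { assert (H := Rpower_pos (INR n) (- a)); nra. }
  induction HKn as [|n HKn IH]; [lra|].
  rewrite tech5. assert (H := Hb (S n) ltac:(lia)).
  assert (Hn0 : 0 < INR n) by (apply lt_0_INR; lia).
  rewrite S_INR in *. set (x := INR n + 1) in *.
  assert (Hx : 0 < x) by (unfold x; lra).
  assert (Hq : 0 < INR n / x) by (apply Rdiv_lt_0_compat; lra).
  assert (HB := Rpower_exp_ineq (INR n / x) (- a)).
  assert (HL := ln_le_minus_1 (INR n / x) Hq).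
  assert (E3 : INR n / x - 1 = - / x) by (unfold x in *; field; lra).
  rewrite E3 in HL.
  assert (E : Rpower (INR n) (- a) = Rpower (INR n / x) (- a) * Rpower x (- a)).
  { rewrite Rpower_mult_distr by lra. f_equal. field. lra. }
  assert (E2 : Rpower x (- a) = x * Rpower x (- 1 - a))
    by (rewrite mul_Rpower by lra; f_equal; ring).
  assert (Hp := Rpower_pos x (- 1 - a)).
  assert (Hstep : a * Rpower x (- 1 - a) <= Rpower (INR n) (- a) - Rpower x (- a)).
  { rewrite E. assert (1 + a * / x <= Rpower (INR n / x) (- a)) by nra.
    assert (0 < Rpower x (- a)) by apply Rpower_pos.
    assert (a * / x * Rpower x (- a) = a * Rpower x (- 1 - a))
      by (rewrite E2; field; lra).
    nra. }
  assert (C * Rpower x (- 1 - a) = C / a * (a * Rpower x (- 1 - a))) by (field; lra).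
  nra.
Qed.

(** Each of the K terms is at least c (2K)^(-1-a), and 2^(-1-a) >= 1/4 because a < 1. *)
Lemma sum_Rpower_block (b : nat -> R) (a c : R) (K : nat) :
  0 < a < 1 -> 0 <= c -> (1 <= K)%nat ->
  (forall k, (1 <= k)%nat -> c * Rpower (INR k) (- 1 - a) <= b k) ->
  c / 4 * Rpower (INR K) (- a) <= sum_f_R0 b (2 * K) - sum_f_R0 b K.
Proof.
  intros Ha Hc HK Hb.
  assert (HK0 : 0 < INR K) by (apply lt_0_INR; lia).
  set (v := c / 4 * Rpower (INR K) (- 1 - a)).
  assert (H := sum_increment_le (fun _ => v) b K (2 * K) ltac:(lia)).
  assert (Hv : c / 4 * Rpower (INR K) (- a) = sum_f_R0 (fun _ => v) (2 * K) - sum_f_R0 (fun _ => v) K).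
  { rewrite !sum_cte, !S_INR, mult_INR. simpl. unfold v.
    replace (Rpower (INR K) (- a)) with (INR K * Rpower (INR K) (- 1 - a))
      by (rewrite mul_Rpower by lra; f_equal; ring).
    ring. }
  rewrite Hv. apply H. intros k Hk.
  apply Rle_trans with (2 := Hb k ltac:(lia)).
  assert (H1 : Rpower (2 * INR K) (- 1 - a) <= Rpower (INR k) (- 1 - a)).
  { apply Rpower_le_anti; [split|lra].
    - apply lt_0_INR; lia.
    - replace 2 with (INR 2) by (simpl; lra). rewrite <- mult_INR. apply le_INR; lia. }
  rewrite <- Rpower_mult_distr in H1 by lra.
  assert (H2 : / 4 <= Rpower 2 (- 1 - a)).
  { apply Rle_trans with (Rpower 2 (- (2))).
    - rewrite Rpower_Ropp. replace 2 with (INR 2) at 2 by (simpl; lra).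
      rewrite Rpower_pow by lra. simpl. lra.
    - apply Rle_Rpower; lra. }
  unfold v. assert (0 < Rpower (INR K) (- 1 - a)) by apply Rpower_pos.
  assert (/ 4 * Rpower (INR K) (- 1 - a) <= Rpower (INR k) (- 1 - a)) by nra.
  unfold Rdiv. nra.
Qed.

(** Supplies the integer scales K comparable to n^(1/a) or to 1/|x|; the factor 2 is absorbed in
    later constants. *)
Lemma nat_between (x : R) : 1 <= x -> exists K : nat, (1 <= K)%nat /\ x <= INR K <= 2 * x.
Proof.
  intros Hx. destruct (nfloor_ex x ltac:(lra)) as [n Hn].
  exists (S n). rewrite S_INR. split; [lia|lra].
Qed.

Lemma Rpower_INR_eventually_ge (s X : R) : 0 < s ->
  exists K0, (1 <= K0)%nat /\ forall K, (K0 <= K)%nat -> X <= Rpower (INR K) s.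
Proof.
  intros Hs. set (Y := Rmax X 1).
  assert (HY : 1 <= Y) by apply Rmax_r.
  destruct (nat_between (1 + Rpower Y (/ s))) as [K0 [H1 [H2 _]]].
  { assert (H := Rpower_pos Y (/ s)). lra. }
  exists K0. split; [exact H1|]. intros K HK. apply le_INR in HK.
  apply Rle_trans with Y; [apply Rmax_l|].
  replace Y with (Rpower (Rpower Y (/ s)) s).
  - apply Rle_Rpower_l; [lra|]. split; [apply Rpower_pos|lra].
  - rewrite Rpower_mult, Rinv_l, Rpower_1; lra.
Qed.

(** * Convolution and differences of sequences *)

Definition cauchy_prod (a b : nat -> R) (k : nat) : R :=
  sum_f_R0 (fun j => a j * b (k - j)%nat) k.

(** The value at 0 follows the convention a(-1) = 0, so [diff] is convolution by delta_0 - delta_1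
    and therefore passes to either factor of a convolution. *)
Definition diff (a : nat -> R) (k : nat) : R :=
  match k with O => a O | S j => a (S j) - a j end.

(** Bounding all partial sums carries both convergence and the norm bound, and keeps the estimates
    on finite sums. *)
Definition l1_le (a : nat -> R) (A : R) : Prop :=
  forall n, sum_f_R0 (fun k => Rabs (a k)) n <= A.

Lemma l1_le_ext (a b : nat -> R) (A : R) :
  (forall k, a k = b k) -> l1_le a A -> l1_le b A.
Proof.
  intros E H n. rewrite (sum_eq _ (fun k => Rabs (a k))); [apply H|].
  intros k _. now rewrite E.
Qed.

Lemma l1_le_weaken (a : nat -> R) (A B : R) : A <= B -> l1_le a A -> l1_le a B.
Proof. intros HAB H n. apply Rle_trans with (2 := HAB). apply H. Qed.

Lemma l1_le_ge0 (a : nat -> R) (A : R) : l1_le a A -> 0 <= A.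
Proof. intros H. apply Rle_trans with (2 := H O). apply Rabs_pos. Qed.

Lemma l1_le_plus (a b : nat -> R) (A B : R) :
  l1_le a A -> l1_le b B -> l1_le (fun k => a k + b k) (A + B).
Proof.
  intros Ha Hb n.
  apply Rle_trans with (sum_f_R0 (fun k => Rabs (a k) + Rabs (b k)) n).
  - apply sum_Rle. intros; apply Rabs_triang.
  - rewrite sum_plus. apply Rplus_le_compat; auto.
Qed.

Lemma cauchy_prod_plus_l (a a' b : nat -> R) (k : nat) :
  cauchy_prod (fun i => a i + a' i) b k = cauchy_prod a b k + cauchy_prod a' b k.
Proof.
  unfold cauchy_prod. rewrite <- sum_plus. apply sum_eq. intros; ring.
Qed.

Lemma cauchy_prod_succ (a b : nat -> R) (k : nat) :
  cauchy_prod a b (S k) = a O * b (S k) + sum_f_R0 (fun i => a (S i) * b (k - i)%nat) k.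
Proof. unfold cauchy_prod. now rewrite decomp_sum by lia. Qed.

Lemma diff_cauchy_prod_l (a b : nat -> R) (k : nat) :
  diff (cauchy_prod a b) k = cauchy_prod (diff a) b k.
Proof.
  destruct k as [|k]; [reflexivity|]. simpl diff.
  rewrite !cauchy_prod_succ. unfold cauchy_prod.
  rewrite (sum_eq (fun i => diff a (S i) * b (k - i)%nat)
    (fun i => a (S i) * b (k - i)%nat - a i * b (k - i)%nat))
    by (intros; simpl; ring).
  rewrite minus_sum. simpl. ring.
Qed.

Lemma diff_cauchy_prod_r (a b : nat -> R) (k : nat) :
  diff (cauchy_prod a b) k = cauchy_prod a (diff b) k.
Proof.
  destruct k as [|k]; [reflexivity|].
  unfold diff at 1, cauchy_prod. rewrite !tech5, Nat.sub_diag. unfold diff at 2.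
  rewrite (sum_eq (fun j => a j * diff b (S k - j)%nat)
    (fun j => a j * b (S k - j)%nat - a j * b (k - j)%nat)).
  - rewrite minus_sum. ring.
  - intros j Hj. rewrite Nat.sub_succ_l by lia. simpl. ring.
Qed.

(** Summation inverts [diff], and [diff] may be moved onto the second factor. *)
Lemma sum_cauchy_prod (a b : nat -> R) (n : nat) :
  sum_f_R0 (cauchy_prod a b) n = cauchy_prod a (sum_f_R0 b) n.
Proof.
  induction n as [|n IH]; [reflexivity|].
  rewrite tech5, IH.
  assert (H := diff_cauchy_prod_r a (sum_f_R0 b) (S n)). simpl diff in H at 1.
  assert (E : cauchy_prod a (diff (sum_f_R0 b)) (S n) = cauchy_prod a b (S n)).
  { apply sum_eq. intros i _. f_equal.
    destruct (S n - i)%nat; simpl; ring. }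
  lra.
Qed.

(** Young's inequality: |a * b| <= |a| * |b| pointwise, and summing the right side replaces |b| by
    its partial sums, all at most B. *)
Lemma l1_le_cauchy_prod (a b : nat -> R) (A B : R) :
  l1_le a A -> l1_le b B -> l1_le (cauchy_prod a b) (A * B).
Proof.
  intros Ha Hb n. assert (HB := l1_le_ge0 _ _ Hb).
  apply Rle_trans with
    (sum_f_R0 (cauchy_prod (fun k => Rabs (a k)) (fun k => Rabs (b k))) n).
  - apply sum_Rle. intros k _. unfold cauchy_prod.
    apply Rle_trans with (1 := Rsum_abs _ _).
    apply Req_le, sum_eq. intros; apply Rabs_mult.
  - rewrite sum_cauchy_prod.
    apply Rle_trans with (sum_f_R0 (fun k => Rabs (a k) * B) n).
    + apply sum_Rle. intros k _. apply Rmult_le_compat_l; [apply Rabs_pos|apply Hb].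
    + rewrite <- scal_sum, Rmult_comm. apply Rmult_le_compat_r; auto.
Qed.

(* The difference operator may be moved to either factor of a convolution:
   it goes to [h] for the part [a] and to [b] itself for the part [b]. *)
Lemma l1_le_diff_split (f a b h : nat -> R) (A B H D : R) :
  (forall k, f k = a k + b k) ->
  l1_le a A -> l1_le (diff b) B -> l1_le h H -> l1_le (diff h) D ->
  l1_le (diff (cauchy_prod f h)) (A * D + B * H).
Proof.
  intros E Ha Hb Hh Hd.
  apply l1_le_ext with
    (fun k => cauchy_prod a (diff h) k + cauchy_prod (diff b) h k).
  - intros k. rewrite <- diff_cauchy_prod_r, <- diff_cauchy_prod_l.
    assert (E' : forall j, cauchy_prod f h j = cauchy_prod a h j + cauchy_prod b h j).
    { intros j. rewrite <- cauchy_prod_plus_l. apply sum_eq. intros; now rewrite E. }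
    destruct k; simpl; rewrite !E'; ring.
  - apply l1_le_plus; now apply l1_le_cauchy_prod.
Qed.

Lemma l1_le_diff (a : nat -> R) (A : R) : l1_le a A -> l1_le (diff a) (2 * A).
Proof.
  intros Ha n.
  (* The second sum bounds the shifted terms |a(k-1)|; at n = 0, [pred] repeats |a 0|, which only
     weakens the bound. *)
  apply Rle_trans with (sum_f_R0 (fun k => Rabs (a k)) n + sum_f_R0 (fun k => Rabs (a k)) (pred n)).
  - destruct n as [|n]; [simpl; assert (H := Rabs_pos (a O)); lra|].
    simpl pred. induction n as [|n IH].
    + simpl. assert (H := Rabs_triang (a 1%nat) (- a O)).
      rewrite Rabs_Ropp in H. unfold Rminus. lra.
    + rewrite (tech5 (fun k => Rabs (diff a k)) (S n)), (tech5 (fun k => Rabs (a k)) (S n)).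
      assert (H : Rabs (diff a (S (S n))) <= Rabs (a (S (S n))) + Rabs (a (S n)))
        by (rewrite <- (Rabs_Ropp (a (S n))); apply Rabs_triang).
      rewrite (tech5 (fun k => Rabs (a k)) n) in *. lra.
  - assert (H1 := Ha n). assert (H2 := Ha (pred n)). lra.
Qed.

Definition restrict_above (K : nat) (a : nat -> R) (k : nat) : R :=
  if (k <=? K)%nat then 0 else a k.

Definition restrict_upto (K : nat) (a : nat -> R) (k : nat) : R :=
  if (k <=? K)%nat then a k else 0.

(** One upward jump of size a(K+1), followed by a descent of total size at most a(K+1). *)
Lemma l1_le_diff_restrict_above (a : nat -> R) (K : nat) :
  (forall k, (K < k)%nat -> 0 <= a (S k) <= a k) -> 0 <= a (S K) ->
  l1_le (diff (restrict_above K a)) (2 * a (S K)).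
Proof.
  intros Ha H0 n.
  (* Past the cutoff the invariant records the variation spent so far: a(K+1) for the jump and
     a(K+1) - a(n) for the descent. *)
  assert (H : (n <= K)%nat /\ sum_f_R0 (fun k => Rabs (diff (restrict_above K a) k)) n = 0
    \/ (K < n)%nat /\ 0 <= a n /\
       sum_f_R0 (fun k => Rabs (diff (restrict_above K a) k)) n <= 2 * a (S K) - a n).
  { induction n as [|n IH].
    - left. split; [lia|]. simpl. apply Rabs_R0.
    - rewrite tech5. unfold diff at 2 4, restrict_above at 2 3 5 6.
      destruct IH as [[Hn IH]|[Hn [H1 IH]]].
      + rewrite IH. replace (n <=? K)%nat with true by (symmetry; apply Nat.leb_le; lia).
        destruct (Nat.leb_spec (S n) K).
        * left. split; [lia|]. rewrite Rminus_diag, Rabs_R0. ring.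
        * right. assert (n = K) by lia. subst n. split; [lia|]. split; [exact H0|].
          rewrite Rminus_0_r, Rabs_pos_eq by exact H0. lra.
      + right. split; [lia|]. assert (H2 := Ha n Hn). split; [lra|].
        replace (n <=? K)%nat with false by (symmetry; apply Nat.leb_gt; lia).
        replace (S n <=? K)%nat with false by (symmetry; apply Nat.leb_gt; lia).
        rewrite Rabs_left1 by lra. lra. }
  destruct H as [[_ H]|[_ [H1 H]]]; rewrite ?H; lra.
Qed.

Lemma restrict_split (K : nat) (a : nat -> R) (k : nat) :
  a k = restrict_upto K a k + restrict_above K a k.
Proof. unfold restrict_upto, restrict_above. destruct (k <=? K)%nat; ring. Qed.

Lemma sum_restrict_upto (K : nat) (a : nat -> R) (n : nat) :
  sum_f_R0 (restrict_upto K a) n = sum_f_R0 a (Nat.min n K).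
Proof.
  induction n as [|n IH].
  - unfold restrict_upto. simpl. reflexivity.
  - rewrite tech5, IH. unfold restrict_upto. destruct (Nat.leb_spec (S n) K).
    + rewrite !Nat.min_l by lia. reflexivity.
    + rewrite !Nat.min_r by lia. ring.
Qed.

Lemma l1_le_restrict_upto (a : nat -> R) (K : nat) :
  (forall k, 0 <= a k) -> l1_le (restrict_upto K a) (sum_f_R0 a K).
Proof.
  intros Ha n.
  rewrite (sum_eq _ (restrict_upto K a)).
  - rewrite sum_restrict_upto.
    assert (H := sum_increment_ge0 a (Nat.min n K) K ltac:(lia) (fun k _ => Ha k)). lra.
  - intros k _. apply Rabs_pos_eq. unfold restrict_upto.
    destruct (k <=? K)%nat; [apply Ha|lra].
Qed.

Fixpoint cauchy_pow (f : nat -> R) (n : nat) : nat -> R :=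
  match n with
  | O => fun k => match k with O => 1 | S _ => 0 end
  | S m => cauchy_prod f (cauchy_pow f m)
  end.

Lemma l1_le_cauchy_pow (f : nat -> R) (n : nat) :
  l1_le f 1 -> l1_le (cauchy_pow f n) 1.
Proof.
  intros Hf. induction n as [|n IH].
  - intros m. apply Req_le. induction m as [|m IHm]; [apply Rabs_R1|].
    rewrite tech5, IHm. simpl. rewrite Rabs_R0. ring.
  - replace 1 with (1 * 1) by ring. now apply l1_le_cauchy_prod.
Qed.

(* Since [diff (1 - partial sums of f) = delta_0 - f], the difference of consecutive
   powers is again the difference of a convolution. *)
Lemma cauchy_pow_consecutive (f : nat -> R) (n k : nat) :
  cauchy_pow f n k - cauchy_pow f (S n) k =
  diff (cauchy_prod (fun j => 1 - sum_f_R0 f j) (cauchy_pow f n)) k.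
Proof.
  rewrite diff_cauchy_prod_l. set (h := cauchy_pow f n).
  simpl cauchy_pow. fold h.
  assert (E : forall j, diff (fun j => 1 - sum_f_R0 f j) j =
    cauchy_pow f O j + (- 1) * f j) by (intros [|j]; simpl; ring).
  destruct k as [|k].
  - unfold cauchy_prod; simpl. ring.
  - rewrite !cauchy_prod_succ. rewrite E.
    rewrite (sum_eq (fun i => diff _ (S i) * _)
      (fun i => (f (S i) * h (k - i)%nat) * (- 1))).
    + rewrite <- scal_sum. simpl. ring.
    + intros i _. rewrite E. simpl. ring.
Qed.

(** * Trigonometric sums and uniform limits *)

(** Product-to-sum telescoping. The phase lets one argument serve both components of the transform:
    0 for the real part, pi/2 for the imaginary part. *)
Lemma sum_sin_shift (x phi : R) (n : nat) :
  2 * sin (x / 2) * sum_f_R0 (fun k => sin (INR k * x + phi)) n =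
  cos (phi - x / 2) - cos (INR n * x + phi + x / 2).
Proof.
  assert (E : forall y, 2 * sin (x / 2) * sin y = cos (y - x / 2) - cos (y + x / 2))
    by (intros y; rewrite cos_minus, cos_plus; ring).
  induction n as [|n IH].
  - simpl. rewrite E. f_equal; f_equal; ring.
  - rewrite tech5, Rmult_plus_distr_l, IH, E, S_INR.
    replace ((INR n + 1) * x + phi - x / 2) with (INR n * x + phi + x / 2) by field.
    ring.
Qed.

(** From sin z >= z - z^3/6 with z^2 <= 81/16. The bound 9/2 leaves room for a neighbourhood of
    radius |x|/8 around any |x| <= 4, and pi <= 4. *)
Lemma sin_half_lower (y : R) : Rabs y <= 9 / 2 -> Rabs y / 20 <= Rabs (sin (y / 2)).
Proof.
  intros Hy.
  assert (H : forall z, 0 <= z <= 9 / 4 -> z / 10 <= sin z).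
  { intros z Hz. assert (H := proj1 (pre_sin_bound z 0 ltac:(lra) ltac:(lra))).
    unfold sin_approx, sin_term in H. simpl in H.
    assert (z * z <= 81 / 16) by nra.
    assert (z * (z * z) <= z * (81 / 16)) by nra. lra. }
  destruct (Rle_dec 0 y) as [Hp|Hn].
  - rewrite !Rabs_pos_eq in *; try assumption.
    + assert (H1 := H (y / 2)). lra.
    + assert (H1 := H (y / 2)). lra.
  - rewrite (Rabs_left y) in * by lra.
    rewrite <- Rabs_Ropp, <- sin_neg, Rabs_pos_eq.
    + assert (H1 := H (- (y / 2))). lra.
    + assert (H1 := H (- (y / 2))). lra.
Qed.

Lemma sum_sin_bound (x phi : R) (n : nat) :
  x <> 0 -> Rabs x <= 9 / 2 ->
  Rabs (sum_f_R0 (fun k => sin (INR k * x + phi)) n) <= 20 / Rabs x.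
Proof.
  intros Hx Hx2. assert (H := sin_half_lower x Hx2).
  assert (Hxp := Rabs_pos_lt x Hx).
  assert (E := f_equal Rabs (sum_sin_shift x phi n)).
  rewrite !Rabs_mult, (Rabs_pos_eq 2) in E by lra.
  set (S := Rabs (sum_f_R0 _ n)) in *. set (s := Rabs (sin (x / 2))) in *.
  assert (HS : 0 <= S) by apply Rabs_pos.
  assert (HE : 2 * s * S <= 2).
  { rewrite E.
    assert (H1 := COS_bound (phi - x / 2)). assert (H2 := COS_bound (INR n * x + phi + x / 2)).
    apply Rabs_le. lra. }
  apply Rmult_le_reg_l with (Rabs x); [exact Hxp|].
  replace (Rabs x * (20 / Rabs x)) with 20 by (field; lra). nra.
Qed.

(** Summation by parts: the boundary terms and the total decrease of b beyond m together cost at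
    most 2 b(m+1). *)
Lemma abel_summation_bound (b e : nat -> R) (B : R) (m n : nat) :
  (forall k, (m < k)%nat -> 0 <= b (S k) <= b k) -> 0 <= b (S m) ->
  (forall k, Rabs (sum_f_R0 e k) <= B) -> (m <= n)%nat ->
  Rabs (sum_f_R0 (fun k => b k * e k) n - sum_f_R0 (fun k => b k * e k) m) <=
  2 * b (S m) * B.
Proof.
  intros Hb H0 HB Hmn. set (s := sum_f_R0 (fun k => b k * e k)).
  assert (HB0 : 0 <= B) by (apply Rle_trans with (2 := HB O); apply Rabs_pos).
  destruct (Nat.eq_dec m n) as [<-|Hne].
  { rewrite Rminus_diag, Rabs_R0. apply Rmult_le_pos; lra. }
  assert (Hn : (S m <= n)%nat) by lia. clear Hmn Hne.
  (* The boundary term at n is set aside; each step adds (b(n) - b(n+1)) times a partial sum of e,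
     and these differences telescope. *)
  assert (H : 0 <= b n /\
    Rabs (s n - s m - b n * sum_f_R0 e n) <= B * (2 * b (S m) - b n)).
  { induction Hn as [|n Hn IH].
    - split; [exact H0|]. unfold s. rewrite !tech5.
      replace (_ - _ - _) with (- (b (S m) * sum_f_R0 e m)) by ring.
      rewrite Rabs_Ropp, Rabs_mult, (Rabs_pos_eq _ H0).
      assert (H1 := HB m). nra.
    - destruct IH as [Hbn IH]. assert (H1 := Hb n ltac:(lia)). split; [lra|].
      unfold s. rewrite (tech5 (fun k => b k * e k)), (tech5 e). fold s.
      replace (_ - _ - _) with
        ((s n - s m - b n * sum_f_R0 e n) + (b n - b (S n)) * sum_f_R0 e n)
        by (unfold s; ring).
      apply Rle_trans with (1 := Rabs_triang _ _).
      rewrite Rabs_mult, (Rabs_pos_eq (b n - b (S n))) by lra.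
      assert (H2 := HB n). nra. }
  destruct H as [Hbn H]. fold (s n) (s m).
  replace (s n - s m) with ((s n - s m - b n * sum_f_R0 e n) + b n * sum_f_R0 e n) by ring.
  apply Rle_trans with (1 := Rabs_triang _ _).
  rewrite Rabs_mult, (Rabs_pos_eq (b n)) by exact Hbn.
  assert (H2 := HB n). nra.
Qed.

(** The interval [1,4] contains k|x| for K < k <= 2K when 1/|x| <= K <= 2/|x|. Beyond pi, the
    reflection y -> 2 pi - y returns to the decreasing branch. *)
Lemma cos_le_cos_1 (y : R) : 1 <= y <= 4 -> cos y <= cos 1.
Proof.
  intros Hy. assert (Hpi := PI2_3_2).
  assert (HPI : PI <= 4) by apply PI_4.
  destruct (Rle_dec y PI).
  - apply cos_decr_1; lra.
  - replace (cos y) with (cos (2 * PI - y)).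
    + apply cos_decr_1; lra.
    + rewrite cos_minus, cos_2PI, sin_2PI. ring.
Qed.

Lemma cos_1_lt_1 : cos 1 < 1.
Proof.
  rewrite <- cos_0 at 2. assert (Hpi := PI2_3_2). apply cos_decreasing_1; lra.
Qed.

(** [Lim_seq] is defined for every sequence and respects order, so the two-sided bound passes to it
    and excludes infinite values. *)
Lemma Lim_seq_abs_le (u : nat -> R) (W : R) :
  (forall n, Rabs (u n) <= W) -> Rabs (real (Lim_seq u)) <= W.
Proof.
  intros H.
  assert (H1 : Rbar_le (Lim_seq u) W).
  { rewrite <- (Lim_seq_const W). apply Lim_seq_le_loc. exists O. intros n _.
    assert (Hn := proj1 (Rabs_le_between _ _) (H n)). simpl. lra. }
  assert (H2 : Rbar_le (- W) (Lim_seq u)).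
  { rewrite <- (Lim_seq_const (- W)). apply Lim_seq_le_loc. exists O. intros n _.
    assert (Hn := proj1 (Rabs_le_between _ _) (H n)). simpl. lra. }
  destruct (Lim_seq u); simpl in *; try easy. now apply Rabs_le.
Qed.

Lemma CVU_cauchy_of_increments (u : nat -> R -> R) (D : R -> Prop) :
  (forall eps, 0 < eps -> exists N, forall m n x, D x -> (N <= m <= n)%nat ->
     Rabs (u n x - u m x) < eps) -> CVU_cauchy u D.
Proof.
  intros H eps. destruct (H eps (cond_pos eps)) as [N HN].
  exists N. intros n m x Hx Hn Hm. destruct (Nat.le_ge_cases m n).
  - apply HN; [exact Hx|lia].
  - rewrite Rabs_minus_sym. apply HN; [exact Hx|lia].
Qed.

(** * Summable sequences with a power tail *)

(** Interface that forgets the explicit sum of powers: g has exact order k^(-1-a), and k g(k)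
    decreases, which yields the monotonicity of g and feeds Abel summation. The decomposition starts
    at k = 1, as g is singular at 0, and the weight [INR 0] removes p(0) from the moment. *)
Record power_tail (f g p : nat -> R) (a c1 c2 M : R) : Prop := {
  pt_exponent : 0 < a < 1;
  pt_c1_pos : 0 < c1;
  pt_nonneg : forall k, 0 <= f k;
  pt_sum : is_series f 1;
  pt_eq : forall k, (1 <= k)%nat -> f k = g k + p k;
  pt_lower : forall k, (1 <= k)%nat -> c1 * Rpower (INR k) (- 1 - a) <= g k;
  pt_upper : forall k, (1 <= k)%nat -> g k <= c2 * Rpower (INR k) (- 1 - a);
  pt_decr : forall k, (1 <= k)%nat -> INR (S k) * g (S k) <= INR k * g k;
  pt_moment : forall n, sum_f_R0 (fun k => INR k * Rabs (p k)) n <= M }.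

Section PowerTail.

Context (f g p : nat -> R) (a c1 c2 M : R) (Hpt : power_tail f g p a c1 c2 M).

Let Ha := pt_exponent _ _ _ _ _ _ _ Hpt.
Let Hc1 := pt_c1_pos _ _ _ _ _ _ _ Hpt.
Let Hf := pt_nonneg _ _ _ _ _ _ _ Hpt.
Let Hsum := pt_sum _ _ _ _ _ _ _ Hpt.
Let Heq := pt_eq _ _ _ _ _ _ _ Hpt.
Let Hlo := pt_lower _ _ _ _ _ _ _ Hpt.
Let Hup := pt_upper _ _ _ _ _ _ _ Hpt.
Let Hdec := pt_decr _ _ _ _ _ _ _ Hpt.
Let Hmom := pt_moment _ _ _ _ _ _ _ Hpt.

Lemma pt_c2_pos : 0 < c2.
Proof.
  assert (H := Rle_trans _ _ _ (Hlo 1%nat (le_n _)) (Hup 1%nat (le_n _))).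
  assert (H1 := Rpower_pos (INR 1) (- 1 - a)). nra.
Qed.

Lemma pt_M_ge0 : 0 <= M.
Proof. assert (H := Hmom O). simpl in H. lra. Qed.

Lemma pt_g_pos (k : nat) : (1 <= k)%nat -> 0 < g k.
Proof.
  intros Hk. assert (H := Hlo k Hk). assert (H1 := Rpower_pos (INR k) (- 1 - a)).
  nra.
Qed.

Lemma pt_g_decr (k : nat) : (1 <= k)%nat -> 0 <= g (S k) <= g k.
Proof.
  intros Hk. assert (H := Hdec k Hk). assert (H1 := pt_g_pos (S k) ltac:(lia)).
  assert (H2 := pt_g_pos k Hk). assert (H3 : 1 <= INR k) by (apply (le_INR 1); lia).
  rewrite S_INR in H. nra.
Qed.

Lemma pt_moment_increment (m n : nat) : (m <= n)%nat ->
  sum_f_R0 (fun k => INR k * Rabs (p k)) n - sum_f_R0 (fun k => INR k * Rabs (p k)) m <= M.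
Proof.
  intros Hmn.
  assert (H0 : 0 <= sum_f_R0 (fun k => INR k * Rabs (p k)) m).
  { apply cond_pos_sum. intros k. apply Rmult_le_pos; [apply pos_INR|apply Rabs_pos]. }
  assert (H := Hmom n). lra.
Qed.

(** Markov's inequality: beyond K, |p(k)| <= k |p(k)| / K. *)
Lemma pt_p_increment (K n : nat) : (1 <= K <= n)%nat ->
  sum_f_R0 (fun k => Rabs (p k)) n - sum_f_R0 (fun k => Rabs (p k)) K <= M / INR K.
Proof.
  intros [HK HKn].
  assert (HK0 : 0 < INR K) by (apply lt_0_INR; lia).
  apply Rle_trans with
    (sum_f_R0 (fun k => INR k * Rabs (p k) * / INR K) n -
     sum_f_R0 (fun k => INR k * Rabs (p k) * / INR K) K).
  - apply sum_increment_le; [exact HKn|]. intros k Hk.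
    apply Rmult_le_reg_r with (INR K); [exact HK0|].
    rewrite Rmult_assoc, Rinv_l by lra. rewrite Rmult_1_r, Rmult_comm.
    apply Rmult_le_compat_r; [apply Rabs_pos|]. apply le_INR; lia.
  - rewrite <- !scal_sum, <- Rmult_minus_distr_l. unfold Rdiv. rewrite Rmult_comm.
    apply Rmult_le_compat_r; [left; now apply Rinv_0_lt_compat|].
    now apply pt_moment_increment.
Qed.

Lemma pt_sum_lim : is_lim_seq (sum_f_R0 f) 1.
Proof.
  apply is_lim_seq_ext with (sum_n f); [intros; apply sum_n_Reals|exact Hsum].
Qed.

Lemma pt_sum_le1 (n : nat) : sum_f_R0 f n <= 1.
Proof.
  apply (is_lim_seq_incr_compare (sum_f_R0 f) 1 pt_sum_lim).
  intros k. rewrite tech5. assert (H := Hf (S k)). lra.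
Qed.

Lemma pt_l1_f : l1_le f 1.
Proof.
  intros n. rewrite (sum_eq _ f); [apply pt_sum_le1|].
  intros; now apply Rabs_pos_eq.
Qed.

Lemma pt_inv_le (K : nat) : (1 <= K)%nat -> / INR K <= Rpower (INR K) (- a).
Proof.
  intros HK. assert (H1 : 1 <= INR K) by (apply (le_INR 1); lia).
  rewrite <- (Rpower_1 (INR K)) at 1 by lra. rewrite <- Rpower_Ropp.
  apply Rle_Rpower; lra.
Qed.

(** The part of g is the telescoped tail sum; that of p is at most M/K <= M K^(-a), since a < 1. *)
Lemma pt_tail (K : nat) : (1 <= K)%nat ->
  1 - sum_f_R0 f K <= (c2 / a + M) * Rpower (INR K) (- a).
Proof.
  intros HK.
  assert (Hc2 := pt_c2_pos). assert (HM := pt_M_ge0).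
  assert (H : Rbar_le 1 (sum_f_R0 f K + (c2 / a + M) * Rpower (INR K) (- a))).
  { apply is_lim_seq_le_loc with (sum_f_R0 f)
      (fun _ => sum_f_R0 f K + (c2 / a + M) * Rpower (INR K) (- a)).
    - exists K. intros n Hn.
      assert (H1 := sum_increment_le f (fun k => g k + Rabs (p k)) K n Hn).
      rewrite !sum_plus in H1.
      assert (H2 := sum_Rpower_tail g a c2 K n ltac:(lra) ltac:(lra) (conj HK Hn) Hup).
      assert (H3 := pt_p_increment K n (conj HK Hn)).
      assert (H4 := pt_inv_le K HK).
      assert (M / INR K <= M * Rpower (INR K) (- a))
        by (apply Rmult_le_compat_l; assumption).
      assert (H5 : sum_f_R0 f n - sum_f_R0 f K <=
        sum_f_R0 g n + sum_f_R0 (fun k => Rabs (p k)) n -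
        (sum_f_R0 g K + sum_f_R0 (fun k => Rabs (p k)) K)).
      { apply H1. intros k Hk. rewrite Heq by lia.
        assert (H5 := Rle_abs (p k)). lra. }
      lra.
    - exact pt_sum_lim.
    - apply is_lim_seq_const. }
  simpl in H. lra.
Qed.

(** M/K is of smaller order than K^(-a), so half of the block mass c1/4 K^(-a) of g survives the
    perturbation. The spare M/K in the second bound pays for p beyond K in [pt_diff_step]. *)
Lemma pt_block :
  exists K0, (1 <= K0)%nat /\ forall K, (K0 <= K)%nat ->
    2 * (M / INR K) <= c1 / 8 * Rpower (INR K) (- a) /\
    c1 / 8 * Rpower (INR K) (- a) + M / INR K <= sum_f_R0 f (2 * K) - sum_f_R0 f K.
Proof.
  (* K^(1-a) >= 16 M / c1 is the first claimed inequality rearranged. *)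
  destruct (Rpower_INR_eventually_ge (1 - a) (16 * M / c1) ltac:(lra)) as [K0 [HK0 H]].
  exists K0. split; [exact HK0|]. intros K HK.
  assert (HKpos : 0 < INR K) by (apply lt_0_INR; lia).
  assert (HMK : 2 * (M / INR K) <= c1 / 8 * Rpower (INR K) (- a)).
  { assert (E : INR K * Rpower (INR K) (- a) = Rpower (INR K) (1 - a))
      by (rewrite mul_Rpower by lra; f_equal; ring).
    assert (H1 := H K HK). rewrite <- E in H1.
    apply Rmult_le_compat_r with (r := c1 / INR K / 8) in H1.
    2: { unfold Rdiv. repeat apply Rmult_le_pos; try lra.
         left; now apply Rinv_0_lt_compat. }
    replace (16 * M / c1 * (c1 / INR K / 8)) with (2 * (M / INR K)) in H1 by (field; lra).
    replace (INR K * Rpower (INR K) (- a) * (c1 / INR K / 8))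
      with (c1 / 8 * Rpower (INR K) (- a)) in H1 by (field; lra).
    exact H1. }
  split; [exact HMK|].
  assert (H1 := sum_Rpower_block g a c1 K Ha ltac:(lra) ltac:(lia) Hlo).
  assert (H2 := pt_p_increment K (2 * K) ltac:(lia)).
  assert (H3 := sum_increment_le g (fun k => f k + Rabs (p k)) K (2 * K) ltac:(lia)).
  rewrite !sum_plus in H3.
  assert (H4 : sum_f_R0 g (2 * K) - sum_f_R0 g K <=
        sum_f_R0 f (2 * K) + sum_f_R0 (fun k => Rabs (p k)) (2 * K) -
        (sum_f_R0 f K + sum_f_R0 (fun k => Rabs (p k)) K)).
  { apply H3. intros k Hk. rewrite Heq by lia.
    assert (H5 := Rle_abs (- p k)). rewrite Rabs_Ropp in H5. lra. }
  lra.
Qed.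

(** * Decay of differences of convolution powers *)

Lemma pt_diff_step :
  exists K0, (1 <= K0)%nat /\ forall (K : nat) (h : nat -> R) (u : R),
    (K0 <= K)%nat -> l1_le h 1 -> l1_le (diff h) u ->
    l1_le (diff (cauchy_prod f h))
      ((1 - c1 / 8 * Rpower (INR K) (- a)) * u + 2 * c2 * Rpower (INR K) (- 1 - a)).
Proof.
  destruct pt_block as [K0 [HK0 Hb]]. exists K0. split; [exact HK0|].
  intros K h u HK Hh Hu.
  assert (HKpos : 0 < INR K) by (apply lt_0_INR; lia).
  (* Only g beyond K is left to the other summand, since p has no monotonicity. The norm of A is at
     most sum_(k <= K) f + M/K, and the mass of f on (K, 2K] brings this below 1. *)
  set (A := fun k => restrict_upto K f k + restrict_above K p k).
  assert (Hp : l1_le (restrict_above K p) (M / INR K)).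
  { intros n.
    (* The maximum covers n < K, where both sides are 0. *)
    assert (H : sum_f_R0 (fun k => Rabs (restrict_above K p k)) n <=
      sum_f_R0 (fun k => Rabs (p k)) (Nat.max n K) - sum_f_R0 (fun k => Rabs (p k)) K).
    { induction n as [|n IH].
      - simpl. unfold restrict_above. simpl. rewrite Rabs_R0. lra.
      - rewrite tech5. unfold restrict_above at 2. destruct (Nat.leb_spec (S n) K).
        + rewrite Rabs_R0. rewrite Nat.max_r in * by lia. lra.
        + rewrite Nat.max_l in * by lia. rewrite tech5. lra. }
    apply Rle_trans with (1 := H). apply pt_p_increment. lia. }
  assert (HA : l1_le A (1 - c1 / 8 * Rpower (INR K) (- a))).
  { apply l1_le_weaken with (sum_f_R0 f K + M / INR K).
    - assert (H := proj2 (Hb K HK)). assert (H1 := pt_sum_le1 (2 * K)). lra.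
    - apply l1_le_plus; [now apply l1_le_restrict_upto|exact Hp]. }
  assert (HB : l1_le (diff (restrict_above K g)) (2 * c2 * Rpower (INR K) (- 1 - a))).
  { apply l1_le_weaken with (2 * g (S K)).
    - assert (H := Hup (S K) ltac:(lia)).
      assert (H1 : Rpower (INR (S K)) (- 1 - a) <= Rpower (INR K) (- 1 - a)).
      { apply Rpower_le_anti; [|lra]. rewrite S_INR. lra. }
      assert (Hc2 := pt_c2_pos). nra.
    - apply l1_le_diff_restrict_above.
      + intros k Hk. apply pt_g_decr. lia.
      + left. apply pt_g_pos. lia. }
  rewrite <- (Rmult_1_r (2 * c2 * _)).
  apply l1_le_diff_split with A (restrict_above K g); try assumption.
  intros k. unfold A, restrict_upto, restrict_above.
  destruct (Nat.leb_spec k K); [ring|]. rewrite Heq by lia. ring.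
Qed.

(* If [u n <= D * n^(-1/a)], taking [K ~ n^(1/a)] in [pt_diff_step] gives
   [u (n+1) <= D * n^(-1/a) * (1 - 1/(a*n)) <= D * (n+1)^(-1/a)]. *)
Lemma pt_diff_pow :
  exists D, 0 < D /\ forall n, (1 <= n)%nat ->
    l1_le (diff (cauchy_pow f n)) (D * Rpower (INR n) (- / a)).
Proof.
  destruct pt_diff_step as [K0 [HK0 Hstep]].
  assert (Hc2 := pt_c2_pos).
  assert (Hia : 0 < / a) by (apply Rinv_0_lt_compat; lra).
  (* With K <= 2 lam n^(1/a), this value makes the contraction term c1/8 K^(-a) at least 2/(a n),
     twice what the induction consumes. *)
  set (lam := Rpower (c1 * a / 16) (/ a) / 2).
  assert (Hq : 0 < c1 * a / 16) by nra.
  assert (Hlam : 0 < lam) by (unfold lam; assert (H := Rpower_pos (c1 * a / 16) (/ a)); lra).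
  assert (Hlam2 : Rpower (2 * lam) (- a) = 16 / (c1 * a)).
  { unfold lam. replace (2 * (Rpower (c1 * a / 16) (/ a) / 2)) with (Rpower (c1 * a / 16) (/ a)) by field.
    rewrite Rpower_mult. replace (/ a * - a) with (- (1)) by (field; lra).
    rewrite Rpower_Ropp, Rpower_1 by lra. field. lra. }
  (* From n0 on, lam n^(1/a) >= K0, so the chosen K is admissible in the one-step estimate. *)
  destruct (Rpower_INR_eventually_ge (/ a) (INR K0 / lam) Hia) as [n0 [Hn0 Hn0']].
  set (L := Rpower lam (- 1 - a)).
  assert (HL : 0 < L) by apply Rpower_pos.
  (* The first summand makes the claim trivial up to n0, where the norm is at most 2; the second
     makes the error 2 c2 L at most D/a. *)
  set (D := 2 * Rpower (INR n0) (/ a) + 2 * a * c2 * L).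
  assert (HD1 : 0 < Rpower (INR n0) (/ a)) by apply Rpower_pos.
  assert (HD2 : 0 < 2 * a * c2 * L) by (repeat apply Rmult_lt_0_compat; lra).
  assert (HD : 0 < D) by (unfold D; lra).
  exists D. split; [exact HD|].
  intros n Hn. induction Hn as [|n Hn IH].
  - apply l1_le_weaken with (2 * 1).
    + replace (Rpower (INR 1) (- / a)) with 1.
      * assert (1 <= Rpower (INR n0) (/ a)); [|unfold D; lra].
        rewrite <- (Rpower_O (INR n0)) by (apply lt_0_INR; lia).
        apply Rle_Rpower; [apply (le_INR 1); lia|lra].
      * unfold Rpower. simpl. rewrite ln_1, Rmult_0_r, exp_0. reflexivity.
    + apply l1_le_diff, l1_le_cauchy_pow, pt_l1_f.
  - assert (Hnpos : 0 < INR n) by (apply lt_0_INR; lia).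
    destruct (le_lt_dec (S n) n0) as [Hle|Hgt].
    + apply l1_le_weaken with (2 * 1).
      * assert (H : Rpower (INR (S n)) (/ a) <= Rpower (INR n0) (/ a)).
        { apply Rle_Rpower_l; [lra|]. split; [apply lt_0_INR; lia|now apply le_INR]. }
        rewrite Rpower_Ropp.
        assert (H1 := Rpower_pos (INR (S n)) (/ a)).
        apply Rmult_le_reg_r with (Rpower (INR (S n)) (/ a)); [exact H1|].
        rewrite (Rmult_assoc D), Rinv_l by lra. unfold D. lra.
      * apply l1_le_diff, l1_le_cauchy_pow, pt_l1_f.
    + set (y := Rpower (INR n) (/ a)).
      assert (Hy : 0 < y) by apply Rpower_pos.
      assert (HK1 : INR K0 <= lam * y).
      { assert (H := Hn0' n ltac:(lia)). fold y in H.
        apply Rmult_le_compat_l with (r := lam) in H; [|lra].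
        replace (lam * (INR K0 / lam)) with (INR K0) in H by (field; lra). exact H. }
      assert (H1K0 : 1 <= INR K0) by (apply (le_INR 1); lia).
      destruct (nat_between (lam * y) ltac:(lra)) as [K [HK [HKlo HKhi]]].
      assert (HKK0 : (K0 <= K)%nat) by (apply INR_le; lra).
      assert (HKpos : 0 < INR K) by lra.
      apply l1_le_weaken with (2 := Hstep K _ _ HKK0 (l1_le_cauchy_pow f n pt_l1_f) IH).
      assert (Ey : Rpower (INR n) (- / a) = / y) by apply Rpower_Ropp.
      assert (Eya : Rpower y (- a) = / INR n).
      { unfold y. rewrite Rpower_mult. replace (/ a * - a) with (- (1)) by (field; lra).
        rewrite Rpower_Ropp, Rpower_1; lra. }
      assert (E1 : 16 / (c1 * a) * / INR n <= Rpower (INR K) (- a)).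
      { rewrite <- Hlam2, <- Eya, Rpower_mult_distr by lra.
        apply Rpower_le_anti; [split; [exact HKpos|lra]|lra]. }
      assert (E2 : Rpower (INR K) (- 1 - a) <= L * (/ y * / INR n)).
      { replace (/ y * / INR n) with (Rpower y (- 1 - a)).
        - unfold L. rewrite Rpower_mult_distr by lra.
          apply Rpower_le_anti; [split; [nra|lra]|lra].
        - rewrite <- Eya. replace (- 1 - a) with (- (1) + - a) by ring.
          rewrite Rpower_plus, (Rpower_Ropp y 1), Rpower_1; lra. }
      rewrite Ey.
      set (z := INR (S n) / INR n).
      assert (Hz : 0 < z) by (apply Rdiv_lt_0_compat; [apply lt_0_INR; lia|lra]).
      assert (E3 : Rpower (INR (S n)) (- / a) = Rpower z (- / a) * / y).
      { rewrite <- Ey, Rpower_mult_distr by lra. f_equal. unfold z. field. lra. }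
      (* z^(-1/a) >= 1 - (ln z)/a, and ln z <= z - 1 = 1/n. *)
      assert (E4 : 1 - / a * / INR n <= Rpower z (- / a)).
      { assert (H1 := Rpower_exp_ineq z (- / a)). assert (H2 := ln_le_minus_1 z Hz).
        replace (z - 1) with (/ INR n) in H2 by (unfold z; rewrite S_INR; field; lra).
        nra. }
      rewrite E3.
      assert (Hiy : 0 < / y) by now apply Rinv_0_lt_compat.
      assert (Hin : 0 < / INR n) by now apply Rinv_0_lt_compat.
      (* Of the gain 2/(a n), one half absorbs the error term ([F2]) and the other pays for passing
         from n to n + 1 ([F3]). *)
      assert (F1 : (1 - c1 / 8 * Rpower (INR K) (- a)) * (D * / y) <=
        (1 - 2 * / a * / INR n) * (D * / y)).
      { apply Rmult_le_compat_r; [nra|].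
        apply Rmult_le_compat_l with (r := c1 / 8) in E1; [|lra].
        replace (c1 / 8 * (16 / (c1 * a) * / INR n)) with (2 * / a * / INR n) in E1
          by (field; lra).
        lra. }
      assert (F2 : 2 * c2 * Rpower (INR K) (- 1 - a) <= / a * D * (/ y * / INR n)).
      { apply Rle_trans with (2 * c2 * (L * (/ y * / INR n))).
        - apply Rmult_le_compat_l; lra.
        - rewrite <- Rmult_assoc. apply Rmult_le_compat_r; [nra|].
          apply Rle_trans with (/ a * (2 * a * c2 * L)).
          + apply Req_le. field. lra.
          + apply Rmult_le_compat_l; [lra|unfold D; lra]. }
      assert (F3 : (1 - / a * / INR n) * (D * / y) <= Rpower z (- / a) * (D * / y))
        by (apply Rmult_le_compat_r; [nra|exact E4]).
      lra.
Qed.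

Lemma pt_consecutive_powers :
  exists B, forall n, (1 <= n)%nat ->
    l1_le (fun k => cauchy_pow f n k - cauchy_pow f (S n) k) (B / INR n).
Proof.
  destruct pt_diff_pow as [D [HD Hpow]].
  set (C := c2 / a + M).
  assert (Hc2 := pt_c2_pos). assert (HM := pt_M_ge0).
  assert (HC : 0 < C).
  { unfold C. assert (0 < c2 / a) by (apply Rdiv_lt_0_compat; lra). lra. }
  (* The summand 1 covers T(0) <= 1, the tail bound being available only from index 1. *)
  set (C' := 1 + C / (1 - a)).
  assert (HC' : 0 < C').
  { unfold C'. assert (0 < C / (1 - a)) by (apply Rdiv_lt_0_compat; lra). lra. }
  exists (2 * C' * D + 2 * C). intros n Hn.
  assert (Hn1 : 1 <= INR n) by (apply (le_INR 1); lia).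
  assert (Hia : 0 < / a) by (apply Rinv_0_lt_compat; lra).
  set (y := Rpower (INR n) (/ a)).
  assert (Hy : 1 <= y).
  { unfold y. rewrite <- (Rpower_O (INR n)) by lra. apply Rle_Rpower; lra. }
  destruct (nat_between y Hy) as [K [HK [HKlo HKhi]]].
  set (T := fun j => 1 - sum_f_R0 f j).
  assert (HT0 : forall j, 0 <= T j) by (intros j; unfold T; assert (H := pt_sum_le1 j); lra).
  assert (HT1 : forall j, (1 <= j)%nat -> T j <= C * Rpower (INR j) (- a))
    by (intros j Hj; now apply pt_tail).
  assert (HTup : l1_le (restrict_upto K T) (C' * Rpower (INR K) (1 - a))).
  { apply l1_le_weaken with (sum_f_R0 T K); [|now apply l1_le_restrict_upto].
    apply Rle_trans with (1 := sum_Rpower_upper T a C K Ha ltac:(lra) HK HT1).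
    assert (T O <= 1) by (unfold T; simpl; assert (H := Hf O); lra).
    assert (1 <= Rpower (INR K) (1 - a)).
    { rewrite <- (Rpower_O (INR K)) at 1 by lra. apply Rle_Rpower; lra. }
    unfold C'. lra. }
  assert (HTab : l1_le (diff (restrict_above K T)) (2 * (C * Rpower (INR K) (- a)))).
  { apply l1_le_weaken with (2 * T (S K)).
    - apply Rmult_le_compat_l; [lra|].
      apply Rle_trans with (1 := HT1 (S K) ltac:(lia)).
      apply Rmult_le_compat_l; [lra|]. apply Rpower_le_anti; [|lra].
      rewrite S_INR. lra.
    - apply l1_le_diff_restrict_above; [|apply HT0].
      intros k _. split; [apply HT0|]. unfold T. rewrite tech5.
      assert (H := Hf (S k)). lra. }
  assert (H := l1_le_diff_split T _ _ _ _ _ _ _ (restrict_split K T) HTup HTab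
    (l1_le_cauchy_pow f n pt_l1_f) (Hpow n Hn)).
  apply l1_le_ext with (diff (cauchy_prod T (cauchy_pow f n)));
    [intros k; symmetry; apply cauchy_pow_consecutive|].
  apply l1_le_weaken with (2 := H).
  assert (Eya : Rpower y (- a) = / INR n).
  { unfold y. rewrite Rpower_mult. replace (/ a * - a) with (- (1)) by (field; lra).
    rewrite Rpower_Ropp, Rpower_1; lra. }
  assert (E1 : Rpower (INR K) (- a) <= / INR n).
  { rewrite <- Eya. apply Rpower_le_anti; lra. }
  (* K^(1-a) = K K^(-a) with K <= 2y; the factor y then cancels the decay 1/y of the differenced
     power. *)
  assert (E2 : Rpower (INR K) (1 - a) <= 2 * (y * / INR n)).
  { replace (Rpower (INR K) (1 - a)) with (INR K * Rpower (INR K) (- a))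
      by (rewrite mul_Rpower by lra; f_equal; ring).
    rewrite <- Rmult_assoc. assert (H1 := Rpower_pos (INR K) (- a)).
    apply Rmult_le_compat; lra. }
  replace (Rpower (INR n) (- / a)) with (/ y) by (symmetry; apply Rpower_Ropp).
  assert (Hiy : 0 < / y) by (apply Rinv_0_lt_compat; lra).
  assert (F1 : C' * Rpower (INR K) (1 - a) * (D * / y) <= C' * (2 * (y * / INR n)) * (D * / y)).
  { apply Rmult_le_compat_r; [nra|]. apply Rmult_le_compat_l; lra. }
  replace (C' * (2 * (y * / INR n)) * (D * / y)) with (2 * C' * D * / INR n) in F1
    by (field; lra).
  unfold Rdiv. nra.
Qed.

(** * Consecutive points of the support *)

Lemma pt_consecutive_support : exists k, f k <> 0 /\ f (S k) <> 0.
Proof.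
  destruct (classic (exists k, f k <> 0 /\ f (S k) <> 0)) as [H|H]; [exact H|exfalso].
  destruct pt_block as [K0 [HK0 Hb]].
  (* Starting one above K0 keeps the shifted block, which begins after K - 1 = K0 >= 1, under the
     moment bound, with M/K0 <= 2M/K. *)
  set (K := S K0). assert (HMK := proj1 (Hb K ltac:(lia))).
  assert (HK0pos : 0 < INR K0) by (apply lt_0_INR; lia).
  assert (HKpos : 0 < INR K) by (apply lt_0_INR; lia).
  assert (HK02 : INR K <= 2 * INR K0).
  { unfold K. rewrite S_INR. assert (1 <= INR K0) by (apply (le_INR 1); lia). lra. }
  set (q := fun k => match k with O => 0 | S j => Rabs (p j) end).
  assert (Hq : forall n, sum_f_R0 q (S n) = sum_f_R0 (fun k => Rabs (p k)) n).
  { intros n. rewrite decomp_sum by lia. simpl. ring. }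
  assert (H1 := sum_increment_le g (fun k => Rabs (p k) + q k) K (2 * K) ltac:(lia)).
  rewrite !sum_plus in H1.
  replace (sum_f_R0 q (2 * K)) with (sum_f_R0 (fun k => Rabs (p k)) (2 * K - 1)) in H1
    by (rewrite <- Hq; f_equal; lia).
  replace (sum_f_R0 q K) with (sum_f_R0 (fun k => Rabs (p k)) K0) in H1 by (now rewrite <- Hq).
  assert (H2 := pt_p_increment K (2 * K) ltac:(lia)).
  assert (H3 := pt_p_increment K0 (2 * K - 1) ltac:(lia)).
  assert (H4 := sum_Rpower_block g a c1 K Ha ltac:(lra) ltac:(lia) Hlo).
  assert (H5 := Rpower_pos (INR K) (- a)).
  assert (HM := pt_M_ge0).
  assert (H6 : M / INR K0 <= 2 * (M / INR K)).
  { replace (2 * (M / INR K)) with (M * (2 / INR K)) by (field; lra).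
    apply Rmult_le_compat_l; [exact HM|].
    apply Rmult_le_reg_r with (INR K0 * INR K); [nra|].
    replace (/ INR K0 * (INR K0 * INR K)) with (INR K) by (field; lra).
    replace (2 / INR K * (INR K0 * INR K)) with (2 * INR K0) by (field; lra). exact HK02. }
  (* With k = j + 1, one of f(j), f(j+1) vanishes, so g(j) = -p(j) or g(j+1) = -p(j+1); in the first
     case g(k) <= g(j). *)
  assert (H7 : forall k, (K < k <= 2 * K)%nat -> g k <= Rabs (p k) + q k).
  { intros [|j] Hj; [lia|]. simpl.
    assert (Hj1 := Heq j ltac:(lia)). assert (Hj2 := Heq (S j) ltac:(lia)).
    assert (Hj3 := pt_g_decr j ltac:(lia)).
    assert (A1 := Rle_abs (- p j)). assert (A2 := Rle_abs (- p (S j))).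
    rewrite Rabs_Ropp in A1, A2.
    assert (A3 := Rabs_pos (p j)). assert (A4 := Rabs_pos (p (S j))).
    destruct (Req_dec (f j) 0) as [E|E]; [lra|].
    destruct (Req_dec (f (S j)) 0) as [E'|E']; [lra|].
    exfalso. apply H. now exists j. }
  (* The block of g would be at most 3M/K <= 3 c1/16 K^(-a), below its lower bound c1/4 K^(-a). *)
  specialize (H1 H7). nra.
Qed.

(** * Lower bound for the real part near zero *)

Lemma pt_ex_series (phi x : R) : ex_series (fun k => f k * cos (INR k * x + phi)).
Proof.
  apply (@ex_series_le R_AbsRing R_CompleteNormedModule) with f; [|now exists 1].
  intros k. change (Rabs (f k * cos (INR k * x + phi)) <= f k).
  rewrite Rabs_mult, (Rabs_pos_eq _ (Hf k)).
  assert (H : Rabs (cos (INR k * x + phi)) <= 1) by (apply Rabs_le; apply COS_bound).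
  assert (H1 := Hf k). nra.
Qed.

Lemma pt_real_part_lower :
  exists e, 0 < e < 1 /\ forall x, 0 < Rabs x <= e ->
    e * Rpower (Rabs x) a <= 1 - Series (fun k => f k * cos (INR k * x)).
Proof.
  destruct pt_block as [K0 [HK0 Hb]].
  assert (Hk := cos_1_lt_1). set (kap := 1 - cos 1) in *.
  assert (Hkap : 0 < kap) by (unfold kap; lra).
  assert (HK0pos : 0 < INR K0) by (apply lt_0_INR; lia).
  (* The first two bounds give 1/|x| >= 1 and 1/|x| >= K0; the third is the constant reached at the
     end, c1/8 from the block, 1/2 from [Hpow], and kap from the cosine. *)
  set (e := Rmin (/ 2) (Rmin (/ INR K0) (kap * c1 / 16))).
  assert (He1 : e <= / 2) by apply Rmin_l.
  assert (He2 : e <= / INR K0) by (eapply Rle_trans; [apply Rmin_r|apply Rmin_l]).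
  assert (He3 : e <= kap * c1 / 16) by (eapply Rle_trans; [apply Rmin_r|apply Rmin_r]).
  assert (He : 0 < e).
  { unfold e. repeat apply Rmin_glb_lt; [lra|now apply Rinv_0_lt_compat|nra]. }
  exists e. split; [lra|]. intros x [Hx Hxe].
  set (y := Rabs x) in *.
  assert (Hy1 : INR K0 <= / y).
  { rewrite <- (Rinv_inv (INR K0)). apply Rinv_le_contravar; lra. }
  assert (Hy2 : 1 <= / y) by (rewrite <- Rinv_1; apply Rinv_le_contravar; lra).
  destruct (nat_between (/ y) Hy2) as [K [HK [HKlo HKhi]]].
  assert (HKK0 : (K0 <= K)%nat) by (apply INR_le; lra).
  assert (HKpos : 0 < INR K) by lra.
  assert (Hs : is_series (fun k => f k * (1 - cos (INR k * x)))
    (1 - Series (fun k => f k * cos (INR k * x)))).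
  { assert (H1 := pt_ex_series 0 x).
    apply (ex_series_ext _ (fun k => f k * cos (INR k * x))) in H1;
      [|intros k; now rewrite Rplus_0_r].
    apply is_series_ext with (fun k => minus (f k) (f k * cos (INR k * x))).
    - intros k. unfold minus, plus, opp; simpl. ring.
    - apply (is_series_minus f); [exact Hsum|]. now apply Series_correct. }
  assert (Hterm : forall k, 0 <= f k * (1 - cos (INR k * x))).
  { intros k. assert (H1 := COS_bound (INR k * x)). assert (H2 := Hf k).
    apply Rmult_le_pos; lra. }
  assert (Hpart : sum_f_R0 (fun k => f k * (1 - cos (INR k * x))) (2 * K) <=
    1 - Series (fun k => f k * cos (INR k * x))).
  { refine (is_lim_seq_incr_compare (sum_f_R0 (fun k => f k * (1 - cos (INR k * x)))) _ _ _ (2 * K)).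
    - apply is_lim_seq_ext with (2 := Hs). intros; apply sum_n_Reals.
    - intros n. rewrite tech5. assert (H1 := Hterm (S n)). lra. }
  apply Rle_trans with (2 := Hpart).
  assert (Hinc := sum_increment_le (fun k => f k * kap)
    (fun k => f k * (1 - cos (INR k * x))) K (2 * K) ltac:(lia)).
  rewrite <- !scal_sum in Hinc.
  assert (H0 : 0 <= sum_f_R0 (fun k => f k * (1 - cos (INR k * x))) K)
    by (now apply cond_pos_sum).
  (* On this block k|x| lies in [1,4], away from the zeros of 1 - cos. *)
  assert (Hcos : forall k, (K < k <= 2 * K)%nat ->
    f k * kap <= f k * (1 - cos (INR k * x))).
  { intros k Hkk. apply Rmult_le_compat_l; [apply Hf|].
    assert (Ec : cos (INR k * x) = cos (INR k * y)).
    { unfold y, Rabs. destruct (Rcase_abs x); [|reflexivity].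
      rewrite Ropp_mult_distr_r_reverse, cos_neg. reflexivity. }
    rewrite Ec. unfold kap.
    assert (Hk1 : INR K <= INR k) by (apply le_INR; lia).
    assert (Hk2 : INR k <= 2 * INR K).
    { replace 2 with (INR 2) by (simpl; lra). rewrite <- mult_INR. apply le_INR; lia. }
    assert (cos (INR k * y) <= cos 1); [|lra].
    assert (Ey : / y * y = 1) by (apply Rinv_l; lra).
    apply cos_le_cos_1. nra. }
  specialize (Hinc Hcos).
  destruct (Hb K HKK0) as [_ HbK].
  assert (HMK : 0 <= M / INR K) by (apply Rdiv_le_0_compat; [apply pt_M_ge0|lra]).
  (* K <= 2/y, and 2^(-a) >= 1/2 because a < 1. *)
  assert (Hpow : / 2 * Rpower y a <= Rpower (INR K) (- a)).
  { apply Rle_trans with (Rpower (2 * / y) (- a)); [|apply Rpower_le_anti; lra].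
    rewrite <- Rpower_mult_distr by lra.
    replace (Rpower (/ y) (- a)) with (Rpower y a).
    - apply Rmult_le_compat_r; [left; apply Rpower_pos|].
      rewrite <- (Rpower_1 2) at 1 by lra. rewrite <- Rpower_Ropp.
      apply Rle_Rpower; lra.
    - unfold Rpower. rewrite ln_Rinv by lra. f_equal. ring. }
  assert (Hyp := Rpower_pos y a).
  apply Rle_trans with (kap * c1 / 16 * Rpower y a); [apply Rmult_le_compat_r; lra|].
  assert (kap * (c1 / 8 * (/ 2 * Rpower y a)) <= kap * (sum_f_R0 f (2 * K) - sum_f_R0 f K)).
  { apply Rmult_le_compat_l; [lra|].
    apply Rle_trans with (c1 / 8 * Rpower (INR K) (- a)); [|lra].
    apply Rmult_le_compat_l; lra. }
  lra.
Qed.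

(** * Termwise differentiation and the derivative bound *)

Lemma pt_derivative_increment (phi x B : R) (m n : nat) : (m <= n)%nat ->
  (forall k, Rabs (sum_f_R0 (fun j => sin (INR j * x + phi)) k) <= B) ->
  Rabs (sum_f_R0 (fun k => INR k * f k * sin (INR k * x + phi)) n -
        sum_f_R0 (fun k => INR k * f k * sin (INR k * x + phi)) m) <=
  2 * c2 * Rpower (INR (S m)) (- a) * B +
  (sum_f_R0 (fun k => INR k * Rabs (p k)) n - sum_f_R0 (fun k => INR k * Rabs (p k)) m).
Proof.
  intros Hmn HB.
  assert (HB0 : 0 <= B) by (apply Rle_trans with (2 := HB O); apply Rabs_pos).
  set (e := fun k => sin (INR k * x + phi)).
  (* The factor [INR k] kills the term k = 0, where f = g + p is not assumed. *)
  assert (E : forall N, sum_f_R0 (fun k => INR k * f k * e k) N =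
    sum_f_R0 (fun k => INR k * g k * e k) N + sum_f_R0 (fun k => INR k * p k * e k) N).
  { intros N. rewrite <- sum_plus. apply sum_eq. intros [|k] _; [simpl; ring|].
    rewrite Heq by lia. ring. }
  fold (e) in HB |- *. change (fun k => INR k * f k * sin (INR k * x + phi))
    with (fun k => INR k * f k * e k). rewrite !E.
  (* Cancellation is used for g only; the terms of p are summed absolutely by the first moment. *)
  assert (H1 : Rabs (sum_f_R0 (fun k => INR k * g k * e k) n -
    sum_f_R0 (fun k => INR k * g k * e k) m) <= 2 * (INR (S m) * g (S m)) * B).
  { apply (abel_summation_bound (fun k => INR k * g k) e); try assumption.
    - intros k Hk. split; [|apply Hdec; lia].
      apply Rmult_le_pos; [apply pos_INR|]. left; apply pt_g_pos; lia.
    - apply Rmult_le_pos; [apply pos_INR|]. left; apply pt_g_pos; lia. }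
  assert (H2 : INR (S m) * g (S m) <= c2 * Rpower (INR (S m)) (- a)).
  { assert (H3 : 0 < INR (S m)) by (apply lt_0_INR; lia).
    replace (Rpower (INR (S m)) (- a)) with (INR (S m) * Rpower (INR (S m)) (- 1 - a))
      by (rewrite mul_Rpower by lra; f_equal; ring).
    assert (H4 := Hup (S m) ltac:(lia)). nra. }
  assert (He : forall k, Rabs (INR k * p k * e k) <= INR k * Rabs (p k)).
  { intros k. rewrite !Rabs_mult, (Rabs_pos_eq _ (pos_INR k)).
    assert (Rabs (e k) <= 1) by (apply Rabs_le; apply SIN_bound).
    assert (0 <= INR k * Rabs (p k)) by (apply Rmult_le_pos; [apply pos_INR|apply Rabs_pos]).
    assert (0 <= Rabs (e k)) by apply Rabs_pos. nra. }
  assert (H3 : Rabs (sum_f_R0 (fun k => INR k * p k * e k) n -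
    sum_f_R0 (fun k => INR k * p k * e k) m) <=
    sum_f_R0 (fun k => INR k * Rabs (p k)) n - sum_f_R0 (fun k => INR k * Rabs (p k)) m).
  { clear - Hmn He. induction Hmn as [|n Hmn IH]; [rewrite !Rminus_diag, Rabs_R0; lra|].
    rewrite !tech5. assert (H := He (S n)).
    assert (H1 := Rabs_triang (sum_f_R0 (fun k => INR k * p k * e k) n -
      sum_f_R0 (fun k => INR k * p k * e k) m) (INR (S n) * p (S n) * e (S n))).
    replace (sum_f_R0 (fun k => INR k * p k * e k) n -
      sum_f_R0 (fun k => INR k * p k * e k) m + INR (S n) * p (S n) * e (S n))
      with (sum_f_R0 (fun k => INR k * p k * e k) n + INR (S n) * p (S n) * e (S n) -
      sum_f_R0 (fun k => INR k * p k * e k) m) in H1 by ring.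
    lra. }
  replace (_ + _ - _) with ((sum_f_R0 (fun k => INR k * g k * e k) n -
    sum_f_R0 (fun k => INR k * g k * e k) m) + (sum_f_R0 (fun k => INR k * p k * e k) n -
    sum_f_R0 (fun k => INR k * p k * e k) m)) by ring.
  apply Rle_trans with (1 := Rabs_triang _ _).
  assert (2 * (INR (S m) * g (S m)) * B <= 2 * c2 * Rpower (INR (S m)) (- a) * B)
    by (apply Rmult_le_compat_r; lra).
  lra.
Qed.

Lemma pt_moment_cauchy (eps : R) : 0 < eps ->
  exists N, forall m n, (N <= m <= n)%nat ->
    sum_f_R0 (fun k => INR k * Rabs (p k)) n - sum_f_R0 (fun k => INR k * Rabs (p k)) m < eps.
Proof.
  intros Heps. set (s := sum_f_R0 (fun k => INR k * Rabs (p k))).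
  assert (Hinc : forall n, s n <= s (S n)).
  { intros n. unfold s. rewrite tech5.
    assert (0 <= INR (S n) * Rabs (p (S n))) by (apply Rmult_le_pos; [apply pos_INR|apply Rabs_pos]).
    lra. }
  destruct (ex_finite_lim_seq_incr s M Hinc Hmom) as [l Hl].
  assert (Hle := is_lim_seq_incr_compare s l Hl Hinc).
  apply is_lim_seq_spec in Hl. destruct (Hl (mkposreal eps Heps)) as [N HN].
  exists N. intros m n Hm. assert (H := HN m ltac:(lia)). simpl in H.
  apply Rabs_def2 in H. assert (H1 := Hle n). lra.
Qed.

Lemma pt_tail_cauchy (eps : R) : 0 < eps ->
  exists N, forall m, (N <= m)%nat -> 1 - sum_f_R0 f m < eps.
Proof.
  intros Heps. assert (Hl := pt_sum_lim). apply is_lim_seq_spec in Hl.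
  destruct (Hl (mkposreal eps Heps)) as [N HN].
  exists N. intros m Hm. assert (H := HN m Hm). simpl in H.
  apply Rabs_def2 in H. lra.
Qed.

Lemma pt_cos_series_uniform (phi : R) (D : R -> Prop) :
  CVU_cauchy (fun n x => sum_f_R0 (fun k => f k * cos (INR k * x + phi)) n) D.
Proof.
  apply CVU_cauchy_of_increments. intros eps Heps.
  destruct (pt_tail_cauchy eps Heps) as [N HN].
  exists N. intros m n x _ [HNm Hmn].
  apply Rle_lt_trans with (2 := HN m HNm).
  apply Rle_trans with (sum_f_R0 f n - sum_f_R0 f m).
  2: { assert (H := pt_sum_le1 n). lra. }
  apply Rabs_le. split.
  - assert (H := sum_increment_le (fun k => f k * (-1)) (fun k => f k * cos (INR k * x + phi)) m n Hmn).
    rewrite <- !scal_sum in H.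
    assert (H1 := H (fun k _ => Rmult_le_compat_l _ _ _ (Hf k) (proj1 (COS_bound _)))). lra.
  - apply sum_increment_le; [exact Hmn|]. intros k _.
    assert (H := COS_bound (INR k * x + phi)). assert (H1 := Hf k). nra.
Qed.

(** Away from 0 the sine sums are bounded by 20/r uniformly in x, while the Abel boundary factor
    (m+1)^(-a) tends to 0. *)
Lemma pt_derivative_uniform (phi r : R) : 0 < r ->
  CVU_cauchy (fun n x => - sum_f_R0 (fun k => INR k * f k * sin (INR k * x + phi)) n)
    (fun x => r <= Rabs x <= 9 / 2).
Proof.
  intros Hr. assert (Hc2 := pt_c2_pos).
  apply CVU_cauchy_of_increments. intros eps Heps.
  set (B := 20 / r).
  assert (HB : 0 < B) by (apply Rdiv_lt_0_compat; lra).
  destruct (pt_moment_cauchy (eps / 2) ltac:(lra)) as [N1 HN1].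
  destruct (Rpower_INR_eventually_ge a (4 * c2 * B / eps + 1) ltac:(lra)) as [N2 [_ HN2]].
  exists (Nat.max N1 N2). intros m n x [Hx1 Hx2] Hmn.
  replace (- _ - - _) with (- (sum_f_R0 (fun k => INR k * f k * sin (INR k * x + phi)) n -
     sum_f_R0 (fun k => INR k * f k * sin (INR k * x + phi)) m)) by ring.
  rewrite Rabs_Ropp.
  assert (Hx0 : x <> 0) by (intros ->; rewrite Rabs_R0 in Hx1; lra).
  assert (HB' : forall k, Rabs (sum_f_R0 (fun j => sin (INR j * x + phi)) k) <= B).
  { intros k. apply Rle_trans with (1 := sum_sin_bound x phi k Hx0 Hx2).
    unfold B, Rdiv. apply Rmult_le_compat_l; [lra|]. apply Rinv_le_contravar; lra. }
  apply Rle_lt_trans with (1 := pt_derivative_increment phi x B m n ltac:(lia) HB').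
  assert (H1 := HN1 m n ltac:(lia)).
  assert (H2 := HN2 (S m) ltac:(lia)).
  assert (H3 : 2 * c2 * Rpower (INR (S m)) (- a) * B <= eps / 2).
  { rewrite Rpower_Ropp. set (X := Rpower (INR (S m)) a) in *.
    assert (HX : 0 < X) by apply Rpower_pos.
    apply Rmult_le_reg_r with (X * (2 / eps)).
    - apply Rmult_lt_0_compat; [exact HX|]. apply Rdiv_lt_0_compat; lra.
    - replace (2 * c2 * / X * B * (X * (2 / eps))) with (4 * c2 * B / eps) by (field; lra).
      replace (eps / 2 * (X * (2 / eps))) with X by (field; lra). lra. }
  lra.
Qed.

Lemma is_derive_cos_sum (phi : R) (n : nat) (x : R) :
  is_derive (fun y => sum_f_R0 (fun k => f k * cos (INR k * y + phi)) n) x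
    (- sum_f_R0 (fun k => INR k * f k * sin (INR k * x + phi)) n).
Proof.
  assert (H : forall b c : R, is_derive (fun y => b * cos (c * y + phi)) x
    (- (c * b * sin (c * x + phi)))) by (intros b c; auto_derive; [easy|ring]).
  induction n as [|n IH]; [apply H|].
  apply is_derive_ext with (fun y => plus
    (sum_f_R0 (fun k => f k * cos (INR k * y + phi)) n) (f (S n) * cos (INR (S n) * y + phi)));
    [reflexivity|].
  rewrite tech5, Ropp_plus_distr. apply (is_derive_plus _ _ x _ _ IH), H.
Qed.

Lemma ex_derive_sin_sum (phi : R) (n : nat) (x : R) :
  ex_derive (fun y => - sum_f_R0 (fun k => INR k * f k * sin (INR k * y + phi)) n) x.
Proof.
  induction n as [|n IH].
  - simpl. auto_derive. easy.
  - apply ex_derive_ext with (fun y => plus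
      (- sum_f_R0 (fun k => INR k * f k * sin (INR k * y + phi)) n)
      (- (INR (S n) * f (S n) * sin (INR (S n) * y + phi)))).
    + intros y. rewrite tech5. unfold plus; simpl. ring.
    + apply (ex_derive_plus (V := R_NormedModule)); [exact IH|]. auto_derive. easy.
Qed.

(** Uniform convergence of the series and of its derivatives near x allows termwise differentiation.
    The derivative is left as a [Lim_seq], ready for bounds uniform in n. *)
Lemma pt_derivative (phi x : R) : x <> 0 -> Rabs x <= 4 ->
  is_derive (fun y => Series (fun k => f k * cos (INR k * y + phi))) x
    (Lim_seq (fun n => - sum_f_R0 (fun k => INR k * f k * sin (INR k * x + phi)) n)).
Proof.
  intros Hx Hx4. assert (Hxp := Rabs_pos_lt x Hx).
  (* This radius keeps |y| >= |x|/2 and |y| <= 9/8 * 4 = 9/2. *)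
  set (r := Rabs x / 8).
  set (D := fun y => x - r < y /\ y < x + r).
  set (fn := fun n y => sum_f_R0 (fun k => f k * cos (INR k * y + phi)) n).
  assert (ED : forall n y, Derive (fn n) y =
    - sum_f_R0 (fun k => INR k * f k * sin (INR k * y + phi)) n)
    by (intros n y; apply is_derive_unique, is_derive_cos_sum).
  assert (HD : forall y, D y -> Rabs x / 2 <= Rabs y <= 9 / 2).
  { intros y [Hy1 Hy2]. unfold r in *.
    destruct (Rcase_abs x) as [Hn|Hn];
      [rewrite (Rabs_left x) in * by lra; rewrite (Rabs_left y) by lra
      |rewrite (Rabs_pos_eq x) in * by lra; rewrite (Rabs_pos_eq y) by lra]; lra. }
  assert (Hmain : is_derive (fun y => real (Lim_seq (fun n => fn n y))) x
    (real (Lim_seq (fun n => Derive (fn n) x)))).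
  { apply CVU_Derive with D.
    - apply open_and; [apply open_gt|apply open_lt].
    - intros u v w [Hu _] [_ Hv] Hw. split; lra.
    - apply CVU_dom_cauchy, pt_cos_series_uniform.
    - intros n y _. eexists. apply is_derive_cos_sum.
    - intros n y _. apply continuity_pt_ext with
        (fun y => - sum_f_R0 (fun k => INR k * f k * sin (INR k * y + phi)) n).
      + intros z. now rewrite ED.
      + apply derivable_continuous_pt, ex_derive_Reals_0, ex_derive_sin_sum.
    - apply CVU_dom_cauchy. intros eps.
      destruct (pt_derivative_uniform phi (Rabs x / 2) ltac:(lra) eps) as [N HN].
      exists N. intros n m y Hy Hn Hm. rewrite !ED. apply HN; auto.
    - unfold D, r. lra. }
  rewrite (Lim_seq_ext _ _ (fun n => ED n x)) in Hmain.
  apply is_derive_ext with (2 := Hmain).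
  intros y. unfold Series. f_equal. apply Lim_seq_ext. intros n.
  symmetry. apply sum_n_Reals.
Qed.

(** Split at K of order 1/|x|: below K absolute values give O(K^(1-a)), beyond K Abel summation
    gives O(K^(-a)/|x|); both are O(|x|^(a-1)). *)
Lemma pt_derivative_bound :
  exists W, 0 < W /\ forall phi x, x <> 0 -> Rabs x <= 4 -> forall n,
    Rabs (- sum_f_R0 (fun k => INR k * f k * sin (INR k * x + phi)) n) <=
    W * Rpower (Rabs x) (a - 1).
Proof.
  assert (Hc2 := pt_c2_pos). assert (HM := pt_M_ge0).
  assert (H1a : 0 < c2 / (1 - a)) by (apply Rdiv_lt_0_compat; lra).
  set (q := c2 / (1 - a)) in *.
  (* 8q comes from K^(1-a) <= 8Y, 40 c2 from the Abel factor 2 c2 times 20, and 8M from two moment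
     bounds M <= 4 M Y, one on each side of K. *)
  exists (8 * q + 40 * c2 + 8 * M). split; [lra|].
  intros phi x Hx Hx4 n. rewrite Rabs_Ropp.
  assert (Hxp := Rabs_pos_lt x Hx). set (y := Rabs x) in *.
  assert (Hy1 : 1 <= 4 / y).
  { apply Rmult_le_reg_r with y; [exact Hxp|]. unfold Rdiv. rewrite Rmult_assoc, Rinv_l; lra. }
  destruct (nat_between (4 / y) Hy1) as [K [HK [HKlo HKhi]]].
  assert (HKpos : 0 < INR K) by (apply lt_0_INR; lia).
  set (s := sum_f_R0 (fun k => INR k * f k * sin (INR k * x + phi))).
  set (Y := Rpower y (a - 1)).
  assert (HY : 0 < Y) by apply Rpower_pos.
  (* Since |x| <= 4, a constant can be absorbed into a multiple of |x|^(a-1). *)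
  assert (HY1 : / 4 <= Y).
  { apply Rle_trans with (Rpower 4 (a - 1)).
    - rewrite <- (Rpower_1 4) at 1 by lra. rewrite <- Rpower_Ropp. apply Rle_Rpower; lra.
    - apply Rpower_le_anti; lra. }
  assert (Hmono : forall b : nat -> R, (forall k, 0 <= b k) -> forall m, (m <= K)%nat ->
    sum_f_R0 b m <= sum_f_R0 b K).
  { intros b Hb m Hm. assert (H := sum_increment_ge0 b m K Hm (fun k _ => Hb k)). lra. }
  assert (Hlow : forall m, (m <= K)%nat -> Rabs (s m) <= (8 * q + 4 * M) * Y).
  { intros m Hm.
    set (b := fun k => INR k * g k).
    assert (Hb0 : forall k, 0 <= b k).
    { intros [|k]; unfold b; [simpl; lra|].
      apply Rmult_le_pos; [apply pos_INR|]. left; apply pt_g_pos; lia. }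
    assert (H1 : Rabs (s m) <= sum_f_R0 (fun k => b k + INR k * Rabs (p k)) m).
    { apply Rle_trans with (1 := Rsum_abs _ _). apply sum_Rle. intros k _.
      rewrite !Rabs_mult, (Rabs_pos_eq _ (pos_INR k)), (Rabs_pos_eq _ (Hf k)).
      assert (Hs : Rabs (sin (INR k * x + phi)) <= 1) by (apply Rabs_le; apply SIN_bound).
      assert (Hk := pos_INR k). assert (Hfk := Hf k).
      apply Rle_trans with (INR k * f k).
      - rewrite <- Rmult_1_r. apply Rmult_le_compat_l; [nra|exact Hs].
      - destruct k as [|k]; [unfold b; simpl; lra|]. rewrite Heq by lia. unfold b.
        assert (H := Rle_abs (p (S k))). nra. }
    rewrite sum_plus in H1.
    assert (H2 := Hmono b Hb0 m Hm). assert (H3 := Hmom m).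
    assert (H4 := sum_Rpower_upper b a c2 K Ha ltac:(lra) HK).
    assert (H5 : sum_f_R0 b K <= b O + q * Rpower (INR K) (1 - a)).
    { apply H4. intros k Hk. unfold b.
      assert (H6 : 0 < INR k) by (apply lt_0_INR; lia).
      replace (Rpower (INR k) (- a)) with (INR k * Rpower (INR k) (- 1 - a))
        by (rewrite mul_Rpower by lra; f_equal; ring).
      assert (H7 := Hup k Hk). nra. }
    assert (H6 : Rpower (INR K) (1 - a) <= 8 * Y).
    { apply Rle_trans with (Rpower (8 * / y) (1 - a)).
      - apply Rle_Rpower_l; [lra|]. split; [lra|]. unfold Rdiv in *. lra.
      - rewrite <- Rpower_mult_distr by (try apply Rinv_0_lt_compat; lra).
        replace (Rpower (/ y) (1 - a)) with Y.
        + apply Rmult_le_compat_r; [lra|]. rewrite <- (Rpower_1 8) at 2 by lra.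
          apply Rle_Rpower; lra.
        + unfold Y, Rpower. rewrite ln_Rinv by lra. f_equal. ring. }
    assert (b O = 0) by (unfold b; simpl; ring).
    assert (q * Rpower (INR K) (1 - a) <= q * (8 * Y))
      by (apply Rmult_le_compat_l; lra).
    assert (M * / 4 <= M * Y) by (apply Rmult_le_compat_l; lra).
    lra. }
  assert (HcY : 0 < c2 * Y) by (apply Rmult_lt_0_compat; lra).
  assert (HMY : 0 <= M * Y) by (apply Rmult_le_pos; lra).
  destruct (Nat.le_gt_cases n K) as [Hn|Hn].
  - assert (H := Hlow n Hn). lra.
  - assert (Hx5 : Rabs x <= 9 / 2) by (fold y; lra).
    assert (H1 := pt_derivative_increment phi x (20 / y) K n ltac:(lia)
      (fun k => sum_sin_bound x phi k Hx Hx5)).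
    assert (H2 := pt_moment_increment K n ltac:(lia)).
    assert (H3 := Hlow K (le_n K)).
    assert (H4 : Rpower (INR (S K)) (- a) <= y * Y).
    { apply Rle_trans with (Rpower (1 * / y) (- a)).
      - assert (0 < / y) by (apply Rinv_0_lt_compat; lra).
        apply Rpower_le_anti; [|lra]. rewrite S_INR. unfold Rdiv in *. lra.
      - unfold Y. rewrite mul_Rpower, Rmult_1_l by lra.
        apply Req_le. unfold Rpower. rewrite ln_Rinv by lra. f_equal. ring. }
    assert (H5 : 2 * c2 * Rpower (INR (S K)) (- a) * (20 / y) <= 40 * c2 * Y).
    { replace (40 * c2 * Y) with (2 * c2 * (y * Y) * (20 / y)) by (field; lra).
      apply Rmult_le_compat_r; [left; apply Rdiv_lt_0_compat; lra|].
      apply Rmult_le_compat_l; lra. }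
    fold s in H1.
    assert (H6 : Rabs (s n) <= Rabs (s K) + Rabs (s n - s K)).
    { replace (s n) with (s K + (s n - s K)) at 1 by ring. apply Rabs_triang. }
    assert (M * / 4 <= M * Y) by (apply Rmult_le_compat_l; lra).
    lra.
Qed.

End PowerTail.

(** * Transfer to functions on the integers and conclusion *)

Lemma is_derive_pair (u v : R -> R) (x du dv : R) :
  is_derive u x du -> is_derive v x dv ->
  is_derive (fun y => (u y, v y) : C) x ((du, dv) : C).
Proof.
  intros Hu Hv.
  apply filterdiff_ext_lin with (fun y : R => (scal y du, scal y dv) : C).
  - apply (filterdiff_comp_2 (F := locally x) u v (fun s t => (s, t) : C) _ _ (fun s t => (s, t) : C) Hu Hv).
    apply filterdiff_ext with (fun t : R * R => t); [now intros []|].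
    apply filterdiff_ext_lin with (fun t : R * R => t); [apply filterdiff_id|now intros []].
  - reflexivity.
Qed.

(** z = z (k+1) - z k. *)
Lemma generates_Z_of_consecutive (S : Z -> Prop) (k : Z) :
  S k -> S (k + 1)%Z -> generates_Z S.
Proof.
  intros H0 H1 z. exists ((z, (k + 1)%Z) :: ((- z)%Z, k) :: nil)%list. split.
  - repeat constructor; assumption.
  - simpl. ring.
Qed.

Lemma convpow_cauchy_pow (F : Z -> R) (n k : nat) :
  convpow F n (Z.of_nat k) = cauchy_pow (fun j => F (Z.of_nat j)) n k.
Proof.
  revert k. induction n as [|n IH]; intros k.
  - destruct k; reflexivity.
  - simpl. unfold conv, cauchy_prod.
    destruct (Z.ltb_spec (Z.of_nat k) 0); [lia|]. rewrite Nat2Z.id.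
    apply sum_eq. intros j Hj. rewrite <- Nat2Z.inj_sub by exact Hj. now rewrite IH.
Qed.

Lemma l1_le_series (u : nat -> R) (A : R) : l1_le u A ->
  ex_series (fun k => Rabs (u k)) /\ Series (fun k => Rabs (u k)) <= A.
Proof.
  intros H.
  assert (Hs : ex_finite_lim_seq (sum_n (fun k => Rabs (u k)))).
  { apply ex_finite_lim_seq_incr with A.
    - intros n. rewrite !sum_n_Reals, tech5. assert (H1 := Rabs_pos (u (S n))). lra.
    - intros n. rewrite sum_n_Reals. apply H. }
  destruct Hs as [l Hl]. split; [now exists l|].
  rewrite (is_series_unique _ l Hl).
  apply (is_lim_seq_le (sum_n (fun k => Rabs (u k))) (fun _ => A) l A).
  - intros n. rewrite sum_n_Reals. apply H.
  - exact Hl.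
  - apply is_lim_seq_const.
Qed.

Lemma increasing_exponents_bounds (alpha : nat -> R) (N : nat) :
  (forall j, (1 <= j)%nat -> (j < N)%nat -> alpha j < alpha (S j)) ->
  forall i, (i < N)%nat -> alpha 1%nat <= alpha (S i) <= alpha N.
Proof.
  intros Hinc.
  assert (Hmono : forall i j, (1 <= i <= j)%nat -> (j <= N)%nat -> alpha i <= alpha j).
  { intros i j [Hi Hij] HjN. induction Hij as [|j Hij IH]; [lra|].
    assert (H1 := Hinc j ltac:(lia) ltac:(lia)). assert (H2 := IH ltac:(lia)). lra. }
  intros i Hi. split; apply Hmono; lia.
Qed.

(** The smallest exponent governs: the first term alone gives the lower bound, k^(-1-alpha_j) <=
    k^(-1-alpha_1) the upper one, and k times each term is a decreasing power. *)
Lemma power_tail_of_decomposition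
  (F : Z -> R) (N : nat) (alpha c : nat -> R) (P : Z -> R) :
  prob_Zplus F -> (1 <= N)%nat -> 0 < alpha 1%nat ->
  (forall j, (1 <= j)%nat -> (j < N)%nat -> alpha j < alpha (S j)) ->
  alpha N < 1 ->
  (forall j, (1 <= j)%nat -> (j <= N)%nat -> 0 < c j) ->
  ex_series (fun k : nat => INR k * Rabs (P (Z.of_nat k))) ->
  (forall k : nat, (1 <= k)%nat -> F (Z.of_nat k) =
     sum_f_R0 (fun i => c (S i) * Rpower (INR k) (- 1 - alpha (S i))) (N - 1)
     + P (Z.of_nat k)) ->
  exists c2 M, power_tail (fun k => F (Z.of_nat k))
    (fun k => sum_f_R0 (fun i => c (S i) * Rpower (INR k) (- 1 - alpha (S i))) (N - 1))
    (fun k => P (Z.of_nat k)) (alpha 1%nat) (c 1%nat) c2 M.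
Proof.
  intros [HF0 [HF1 HF2]] HN Ha1 Hinc HaN Hc HP Hdec.
  assert (Hb := increasing_exponents_bounds alpha N Hinc).
  assert (Hcpos : forall i, (i <= N - 1)%nat -> 0 < c (S i)) by (intros; apply Hc; lia).
  exists (sum_f_R0 (fun i => c (S i)) (N - 1)), (Series (fun k : nat => INR k * Rabs (P (Z.of_nat k)))).
  constructor.
  - assert (H := Hb O ltac:(lia)). lra.
  - apply Hc; lia.
  - intros k. apply HF1.
  - exact HF2.
  - exact Hdec.
  - intros k Hk.
    assert (H := sum_increment_ge0 (fun i => c (S i) * Rpower (INR k) (- 1 - alpha (S i)))
      0 (N - 1) ltac:(lia)). simpl in H.
    assert (H1 : 0 <= sum_f_R0 (fun i => c (S i) * Rpower (INR k) (- 1 - alpha (S i))) (N - 1)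
      - c 1%nat * Rpower (INR k) (- 1 - alpha 1%nat)); [|lra].
    apply H. intros i Hi. apply Rmult_le_pos; left; [apply Hcpos; lia|apply Rpower_pos].
  - intros k Hk. rewrite Rmult_comm, scal_sum. apply sum_Rle. intros i Hi.
    apply Rmult_le_compat_l; [left; apply Hcpos; lia|].
    apply Rle_Rpower; [apply (le_INR 1); lia|].
    assert (H := Hb i ltac:(lia)). lra.
  - intros k Hk. rewrite !scal_sum. apply sum_Rle. intros i Hi.
    rewrite !Rmult_assoc. apply Rmult_le_compat_l; [left; apply Hcpos; lia|].
    rewrite !(Rmult_comm (Rpower _ _)).
    assert (H : 0 < INR k) by (apply lt_0_INR; lia).
    assert (H1 := Hb O ltac:(lia)). assert (H2 := Hb i ltac:(lia)).
    rewrite !mul_Rpower by (try apply lt_0_INR; lia || lra).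
    apply Rpower_le_anti; [|lra]. rewrite S_INR. lra.
  - intros n. apply (is_lim_seq_incr_compare
      (sum_f_R0 (fun k => INR k * Rabs (P (Z.of_nat k))))).
    + apply is_lim_seq_ext with (sum_n (fun k => INR k * Rabs (P (Z.of_nat k))));
        [intros; apply sum_n_Reals|]. now apply Series_correct.
    + intros m. rewrite tech5.
      assert (0 <= INR (S m) * Rabs (P (Z.of_nat (S m))))
        by (apply Rmult_le_pos; [apply pos_INR|apply Rabs_pos]).
      lra.
Qed.

Theorem theorem5p5
  (F : Z -> R) (N : nat) (alpha c : nat -> R) (P : Z -> R)
  (HF : prob_Zplus F)
  (HN : (1 <= N)%nat)
  (Halpha_pos : 0 < alpha 1%nat)
  (Halpha_inc : forall j, (1 <= j)%nat -> (j < N)%nat -> alpha j < alpha (S j))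
  (Halpha_lt1 : alpha N < 1)
  (Hc : forall j, (1 <= j)%nat -> (j <= N)%nat -> 0 < c j)
  (HP0 : vanishes_neg P)
  (HP1 : ex_series (fun k : nat => Rabs (P (Z.of_nat k))))
  (HPk : ex_series (fun k : nat => INR k * Rabs (P (Z.of_nat k))))
  (Hdecomp : forall k : nat, (1 <= k)%nat ->
     F (Z.of_nat k) =
       sum_f_R0 (fun i => c (S i) * Rpower (INR k) (- 1 - alpha (S i))) (N - 1)
       + P (Z.of_nat k)) :
  aperiodic F /\
  (exists eps cc : R, 0 < eps < 1 /\ 0 < cc /\
     (forall xi : R, - eps <= xi <= eps -> xi <> 0 ->
        1 - fst (Fhat F xi) >= eps * Rpower (Rabs xi) (alpha 1%nat)) /\
     (forall xi : R, - PI <= xi <= PI -> xi <> 0 ->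
        exists d : C, is_derive (Fhat F) xi d /\
          Cmod d <= cc * Rpower (Rabs xi) (alpha 1%nat - 1))) /\
  classA F.
Proof.
  destruct (power_tail_of_decomposition F N alpha c P) as [c2 [M Hpt]]; try assumption.
  split; [|split].
  (* Translation preserves consecutiveness, so one pair serves every m. *)
  - intros m. destruct (pt_consecutive_support _ _ _ _ _ _ _ Hpt) as [k [H0 H1]].
    apply generates_Z_of_consecutive with (Z.of_nat k + m)%Z; unfold supp, translate.
    + now replace (Z.of_nat k + m - m)%Z with (Z.of_nat k) by ring.
    + now replace (Z.of_nat k + m + 1 - m)%Z with (Z.of_nat (S k)) by lia.
  - destruct (pt_real_part_lower _ _ _ _ _ _ _ Hpt) as [e [He Hlow]].
    destruct (pt_derivative_bound _ _ _ _ _ _ _ Hpt) as [W [HW Hder]].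
    exists e, (2 * W). split; [exact He|]. split; [lra|]. split.
    + intros xi Hxi Hxi0. apply Rle_ge, Hlow. split; [now apply Rabs_pos_lt|].
      apply Rabs_le; lra.
    + intros xi Hxi Hxi0.
      assert (Hxi4 : Rabs xi <= 4).
      { assert (H := PI_4). apply Rabs_le; lra. }
      set (f := fun k => F (Z.of_nat k)) in *.
      set (D := fun phi => real (Lim_seq (fun n =>
        - sum_f_R0 (fun k => INR k * f k * sin (INR k * xi + phi)) n))).
      assert (HD : forall phi, Rabs (D phi) <= W * Rpower (Rabs xi) (alpha 1%nat - 1))
        by (intros phi; apply Lim_seq_abs_le; intros n; now apply Hder).
      (* cos(t + pi/2) = -sin t, so the phase pi/2 gives the imaginary part with its sign. *)
      exists (D 0, D (PI / 2)). split.
      * apply is_derive_ext with (fun y => (Series (fun k => f k * cos (INR k * y + 0)),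
          Series (fun k => f k * cos (INR k * y + PI / 2))) : C).
        -- intros y. unfold Fhat. f_equal.
           ++ apply Series_ext. intros k. now rewrite Rplus_0_r.
           ++ rewrite <- Series_opp. apply Series_ext. intros k.
              rewrite (sin_cos (INR k * y)), (Rplus_comm _ (PI / 2)). unfold f. ring.
        -- apply is_derive_pair; apply (pt_derivative _ _ _ _ _ _ _ Hpt); assumption.
      (* The modulus is at most sqrt 2 times the larger component, whence the constant 2W. *)
      * eapply Rle_trans; [apply Cmod_2Rmax|].
        assert (Hs : sqrt 2 <= 2).
        { rewrite <- (sqrt_square 2) at 2 by lra. apply sqrt_le_1; lra. }
        rewrite Rmult_assoc. apply Rmult_le_compat; [apply sqrt_pos| |exact Hs|].
        -- apply Rle_trans with (2 := Rmax_l _ _). apply Rabs_pos.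
        -- apply Rmax_lub; apply HD.
  - split; [exact HF|].
    destruct (pt_consecutive_powers _ _ _ _ _ _ _ Hpt) as [B HB].
    exists B. intros n Hn.
    assert (Hl : l1_le (fun k => convpow F n (Z.of_nat k) - convpow F (S n) (Z.of_nat k))
      (B / INR n)).
    { apply l1_le_ext with (2 := HB n Hn). intros k. now rewrite !convpow_cauchy_pow. }
    destruct (l1_le_series _ _ Hl) as [Hex Hle]. split; [exact Hex|].
    assert (HnR : 0 < INR n) by (apply lt_0_INR; lia).
    apply Rmult_le_compat_l with (r := INR n) in Hle; [|lra].
    replace (INR n * (B / INR n)) with B in Hle by (field; lra). exact Hle.
Qed.
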